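(* Let $V$ be a reflexive Banach space and $1<p<\infty$. A function $g\in L^p_b(\mathbb R,V)$ is both space regular and time regular if and only if it is translation compact.
   Context: $L^p_b(\mathbb R,V)$ is the space of $g\in L^p_{loc}(\mathbb R,V)$ with $\|g\|_{L^p_b}:=\sup_{s\in\mathbb R}\|g\|_{L^p((s,s+1),V)}<\infty$. $g$ is translation compact if the orbit $\{g(\cdot+s):s\in\mathbb R\}$ is precompact in the Fréchet space $L^p_{loc}(\mathbb R,V)$. $g$ is space regular if for every $\varepsilon>0$ there are a finite-dimensional subspace $V_\varepsilon\subset V$ and $g_\varepsilon\in L^p_b(\mathbb R,V_\varepsilon)$ with $\|g-g_\varepsilon\|_{L^p_b(\mathbb R,V)}\le\varepsilon$. $g$ is time regular if for every $\varepsilon>0$ there is $g_\varepsilon$ belonging to $C^k_b(\mathbb R,V)$ for all $k$ with $\|g-g_\varepsilon\|_{L^p_b(\mathbb R,V)}\le\varepsilon$. *)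

(* Defs.v *)
From HB Require Import structures.
From mathcomp Require Import all_boot all_order all_algebra.
From mathcomp Require Import all_classical all_reals all_analysis.
Set Implicit Arguments. Unset Strict Implicit. Unset Printing Implicit Defensive.
Import Order.TTheory GRing.Theory Num.Theory.
Import numFieldNormedType.Exports.
Local Open Scope classical_set_scope.
Local Open Scope ring_scope.

Section Defs.
Context {R : realType} {V : normedModType R}.

Definition dual_elt (f : V -> R) : Prop :=
  (forall (a : R) (x y : V), f (a *: x + y) = a * f x + f y) /\ continuous f.

Definition dual_bound (f : V -> R) (M : R) : Prop :=
  0 <= M /\ forall x : V, `|f x| <= M * `|x|.

Definition reflexive_space : Prop :=
  forall Phi : (V -> R) -> R,
    (forall (a : R) (f g : V -> R), dual_elt f -> dual_elt g ->
        Phi (fun x => a * f x + g x) = a * Phi f + Phi g) ->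
    (exists C : R, forall (f : V -> R) (M : R), dual_elt f -> dual_bound f M ->
        `|Phi f| <= C * M) ->
    exists v : V, forall f : V -> R, dual_elt f -> Phi f = f v.

Definition simple_fun (f : R -> V) : Prop :=
  finite_set (range f) /\ forall v : V, measurable (f @^-1` [set v]).

Definition strongly_measurable (g : R -> V) : Prop :=
  exists f : nat -> R -> V, (forall n, simple_fun (f n)) /\
    {ae (@lebesgue_measure R), forall t, (fun n => f n t) @ \oo --> g t}.

Definition Lp_int (p : R) (f : R -> V) (A : set R) : \bar R :=
  (\int[@lebesgue_measure R]_(t in A) ((`|f t| `^ p)%:E))%E.

Definition Lp_norm (p : R) (f : R -> V) (A : set R) : \bar R :=
  ((Lp_int p f A) `^ p^-1)%E.

Definition Lpb_norm (p : R) (f : R -> V) : \bar R :=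
  ereal_sup [set Lp_norm p f `]s, s + 1[ | s in [set: R]].

Definition Lp_loc (p : R) (f : R -> V) : Prop :=
  strongly_measurable f /\
  forall a b : R, (Lp_int p f `[a, b] < +oo)%E.

Definition Lp_b (p : R) (f : R -> V) : Prop :=
  Lp_loc p f /\ (Lpb_norm p f < +oo)%E.

Definition Lploc_cvg (p : R) (u : nat -> R -> V) (h : R -> V) : Prop :=
  forall a b : R,
    (fun n => Lp_norm p (fun t => u n t - h t) `[a, b]) @ \oo --> 0%E.

(** g is translation compact: the orbit {g(.+s) : s in R} is precompact in
    L^p_loc(R,V) (relative sequential compactness in the metrizable space
    L^p_loc: every sequence of translates has a subsequence converging in
    L^p_loc(R,V)). *)
Definition translation_compact (p : R) (g : R -> V) : Prop :=
  forall s : nat -> R, exists (phi : nat -> nat) (h : R -> V),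
    {homo phi : m n / (m < n)%N >-> (m < n)%N} /\ Lp_loc p h /\
    Lploc_cvg p (fun n t => g (t + s (phi n))) h.

Definition space_regular (p : R) (g : R -> V) : Prop :=
  forall eps : R, 0 < eps ->
    exists (n : nat) (e : 'I_n -> V) (ge : R -> V),
      (forall t, exists c : 'I_n -> R, ge t = \sum_(i < n) c i *: e i) /\
      Lp_b p ge /\ (Lpb_norm p (fun t => (g t - ge t)%R) <= eps%:E)%E.

Definition Cinf_b (f : R -> V) : Prop :=
  forall k : nat,
    (forall x : R, derivable (derive1n k f) x 1) /\
    continuous (derive1n k f) /\
    exists M : R, forall x : R, `|derive1n k f x| <= M.

Definition time_regular (p : R) (g : R -> V) : Prop :=
  forall eps : R, 0 < eps ->
    exists ge : R -> V, Cinf_b ge /\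
      (Lpb_norm p (fun t => (g t - ge t)%R) <= eps%:E)%E.

End Defs.

(* Main.v *)
Require Import Defs.
From HB Require Import structures.
From mathcomp Require Import all_boot all_order all_algebra.
From mathcomp Require Import all_classical all_reals all_analysis.
From mathcomp Require Import measurable_realfun ring lra zify.
Import Order.TTheory GRing.Theory Num.Theory.
Import numFieldNormedType.Exports.
Local Open Scope classical_set_scope.
Local Open Scope ring_scope.
Set Implicit Arguments. Unset Strict Implicit. Unset Printing Implicit Defensive.

(** Both sides are equivalent to [step_approximable]: up to eps, every translate of g is a step
    function on one fixed uniform grid, with values in one fixed finite subset of V.

    Regularity implies step approximability: if g1 is a smooth and g2 a finite-dimensional
    approximation of g, then on each small cell some point tau has |g1 - g2|(tau) at most the
    L^p mean of g1 - g2 over the cell, so the value g2(tau) approximates the Lipschitz function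
    g1 on the whole cell; these values stay in a bounded part of a finite-dimensional space
    and can be rounded to a finite net.

    Step approximability implies translation compactness: on a bounded window the steps take
    finitely many patterns, so a diagonal pigeonhole argument gives a subsequence of translates
    close to simple functions W_m with W_m - W_(m+1) geometrically small, and the W_m converge
    almost everywhere and in L^p.

    Translation compactness implies step approximability: finitely many translates are an
    eps-net on the unit window, and each is close in L^p to a continuous function, hence to a step
    function.

    A step-approximable g is close to a step function with finitely many values, which is space
    regular, and smoothing each jump on a short interval makes it time regular.

    The integral of a non-measurable nonnegative function is its lower integral, so [Lp_int] is
    monotone in general but subadditive only for strongly measurable functions. *)

(** * Integrals of strongly measurable functions *)

Section LowerIntegral.
Import HBNNSimple.
Context d (T : measurableType d) (R : realType).
Variable mu : {measure set T -> \bar R}.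

(* No measurability is assumed: a simple function below f on A, cut off on the null set, is below
   f' on B. *)
Lemma ae_le_lower_integral (A B : set T) (f f' : T -> \bar R) :
  (forall x, (0 <= f x)%E) -> (forall x, (0 <= f' x)%E) ->
  {ae mu, forall x, A x -> B x /\ (f x <= f' x)%E} ->
  (\int[mu]_(x in A) f x <= \int[mu]_(x in B) f' x)%E.
Proof.
move=> f0 f'0 [N [mN N0 sN]]; rewrite [leLHS]ge0_integralE// [leRHS]ge0_integralE//.
apply: ge_ereal_sup => _ [h /= hf <-].
pose h' := mul_nnsfun h (indic_nnsfun R (measurableC mN)).
have hE x : (h \* mindic R (measurableC mN)) x = h x * \1_(~` N) x by [].
apply: ereal_sup_ubound; exists h' => [x|]; rewrite /h' /=.
  rewrite -[X in X%:E]/(h x * \1_(~` N) x) indicE; case: (pselect (N x)) => Nx.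
    rewrite (@memNset _ (~` N)) ?mulr0//.
    by rewrite patchE; case: ifP.
  rewrite mem_set// mulr1; apply: le_trans (hf x) _.
  have [Ax|nAx] := pselect (A x); last first.
    by rewrite !patchE memNset//; case: ifP.
  have [Bx ff'] : B x /\ (f x <= f' x)%E.
    by apply: contrapT => H; apply: Nx; apply: sN => /= /(_ Ax).
  by rewrite !patchE !mem_set.
rewrite -!integralT_nnsfun; apply: ge0_ae_eq_integral => //=.
- exact/measurable_EFinP/(measurable_funP h').
- exact/measurable_EFinP/measurable_funP.
- by move=> x _; rewrite lee_fin mulr_ge0// /mindic indicE.
- by move=> x _; rewrite lee_fin.
exists N; split => // x /= H; apply: contrapT => Nx; apply: H => _.
by rewrite /mindic indicE mem_set// mulr1.
Qed.

Lemma ae_imp (P Q : T -> Prop) : (forall x, P x -> Q x) ->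
  {ae mu, forall x, P x} -> {ae mu, forall x, Q x}.
Proof. by move=> PQ; apply: (@filterS _ _ (ae_filter_ringOfSetsType mu)). Qed.

Lemma ae_imp2 (P Q S : T -> Prop) : (forall x, P x -> Q x -> S x) ->
  {ae mu, forall x, P x} -> {ae mu, forall x, Q x} -> {ae mu, forall x, S x}.
Proof. by move=> PQ; apply: (@filterS2 _ _ (ae_filter_ringOfSetsType mu)). Qed.

End LowerIntegral.

Section Simple.
Context {R : realType} {V : normedModType R}.
Implicit Types f g h : R -> V.
Local Notation mu := (@lebesgue_measure R).

(** No sigma-algebra on V enters: f has finitely many values, so the preimage of any set is a finite
    union of measurable level sets. *)
Lemma simple_preimage f (B : set V) : simple_fun f -> measurable (f @^-1` B).
Proof.
move=> [ff mf].
have -> : f @^-1` B = \bigcup_(v in range f `&` B) (f @^-1` [set v]).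
  apply/seteqP; split => [t Bt|t [v [_ Bv] /= ftv]]; last by rewrite /= ftv.
  by exists (f t) => //; split.
apply: fin_bigcup_measurable => // ; exact: finite_setIl.
Qed.

Lemma simple_preimage2 f g (C : set (V * V)) : simple_fun f -> simple_fun g ->
  measurable [set t | C (f t, g t)].
Proof.
move=> sf sg.
have -> : [set t | C (f t, g t)] = \bigcup_(v in range f)
    (f @^-1` [set v] `&` g @^-1` [set w | C (v, w)]).
  apply/seteqP; split => [t Ct|t [v _ [/= <- //]]].
  by exists (f t) => //; split.
apply: fin_bigcup_measurable; first exact: sf.1.
by move=> v _; apply: measurableI; exact: simple_preimage.
Qed.

Lemma simple_fun2 (F : V -> V -> V) f g : simple_fun f -> simple_fun g ->
  simple_fun (fun t => F (f t) (g t)).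
Proof.
move=> sf sg; split; last first.
  by move=> v; exact: (simple_preimage2 [set vw | F vw.1 vw.2 = v] sf sg).
apply: (sub_finite_set _ (finite_image2 F sf.1 sg.1)) => _ [t _ <-].
by exists (f t) => //; exists (g t).
Qed.

(** With convergence everywhere, |f| is measurable for the sigma-algebra at hand, which need not
    contain all subsets of null sets; integrals of |f|^p are then additive. *)
Definition simple_limit f := exists u : nat -> R -> V,
  (forall n, simple_fun (u n)) /\ forall t, u ^~ t @ \oo --> f t.

Lemma simple_fun_limit f : simple_fun f -> simple_limit f.
Proof. by move=> sf; exists (fun=> f); split => // t; exact: cvg_cst. Qed.

Lemma simple_limitB f g :
  simple_limit f -> simple_limit g -> simple_limit (fun t => f t - g t).
Proof.
move=> [u [su uf]] [v [sv vg]]; exists (fun n t => u n t - v n t); split => [n|t].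
  exact: (simple_fun2 (fun x y => x - y)).
exact: cvgB.
Qed.

Lemma simple_limit_measurable f : simple_limit f ->
  measurable_fun setT (fun t => `|f t|).
Proof.
move=> [u [su uf]].
apply: (@measurable_fun_cvg _ _ _ _ (fun n t => `|u n t|)).
  move=> n _ B mB; rewrite setTI.
  exact: (@simple_preimage (u n) [set v | B `|v|]).
by move=> t _; apply: cvg_norm.
Qed.

(** Approximants and limit are both set to 0 on a measurable null set that contains the points
    without convergence. *)
Lemma strongly_measurable_version f : strongly_measurable f ->
  exists2 f0, simple_limit f0 & {ae mu, forall t, f t = f0 t}.
Proof.
move=> [u [su [N [mN N0 sN]]]].
pose f0 t := if t \in N then 0 else f t.
exists f0.
  exists (fun n t => if t \in N then 0 else u n t); split => [n|t].
    split.
      apply: (@sub_finite_set _ _ (0 |` range (u n))).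
        by move=> _ [t _ <-]; case: ifP => _; [left|right].
      by rewrite finite_setU; split => //; exact: (su n).1.
    move=> v.
    have -> : (fun t => if t \in N then 0 else u n t) @^-1` [set v] =
      (N `&` [set _ | 0 = v]) `|` (~` N `&` u n @^-1` [set v]).
      apply/seteqP; split => t /=.
        by case: ifPn => [/set_mem Nt|/negP Nt]; [left|right; split=> // /mem_set].
      by case=> -[Nt]; [rewrite mem_set|rewrite memNset].
    apply: measurableU; apply: measurableI => //.
    - by have [->|/eqP nv] := eqVneq 0 v; [rewrite (_ : mkset _ = setT)//; apply/seteqP; split
         |rewrite (_ : mkset _ = set0)//; apply/seteqP; split].
    - exact: measurableC.
    - exact: (su n).2.
  rewrite /f0; case: ifPn => [_|/negP Nt]; first exact: cvg_cst.
  by apply: contrapT => H; apply: Nt; apply/mem_set/sN.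
exists N; split => // t /=; rewrite /f0; case: ifP => // /set_mem //.
Qed.

Lemma simple_limit_strongly_measurable f f0 :
  simple_limit f0 -> {ae mu, forall t, f t = f0 t} -> strongly_measurable f.
Proof.
move=> [u [su uf]] ff; exists u; split => //.
by apply: ae_imp ff => t ->.
Qed.

Lemma strongly_measurableB f g : strongly_measurable f -> strongly_measurable g ->
  strongly_measurable (fun t => f t - g t).
Proof.
move=> [u [su uf]] [v [sv vg]]; exists (fun n t => u n t - v n t); split => [n|].
  exact: (simple_fun2 (fun x y => x - y)).
by apply: ae_imp2 uf vg => t; exact: cvgB.
Qed.

Lemma simple_fun_strongly_measurable f : simple_fun f -> strongly_measurable f.
Proof. by move=> sf; exists (fun=> f); split => //; apply: aeW => t; exact: cvg_cst. Qed.

End Simple.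

(** * Integrals of p-th powers of the norm over intervals *)

Section LpInt.
Context {R : realType} {V : normedModType R}.
Implicit Types f g h : R -> V.
Local Notation mu := (@lebesgue_measure R).
Variable p : R.

(** All estimates are made on p-th powers, without the root; the conversion to [Lp_norm] and
    [Lpb_norm] is left to separate lemmas. *)
Lemma Lp_int_ge0 f A : (0 <= Lp_int p f A)%E.
Proof. by apply: integral_ge0 => t _; rewrite lee_fin powR_ge0. Qed.

Lemma ae_le_Lp_int f g A B :
  {ae mu, forall t, A t -> B t /\ `|f t| `^ p <= `|g t| `^ p} ->
  (Lp_int p f A <= Lp_int p g B)%E.
Proof.
move=> fg; apply: ae_le_lower_integral => [x|x|]; rewrite ?lee_fin ?powR_ge0//.
Qed.

Lemma Lp_int_subset f A B : A `<=` B -> (Lp_int p f A <= Lp_int p f B)%E.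
Proof. by move=> AB; apply: ae_le_Lp_int; apply: aeW => t /AB. Qed.

Lemma ae_eq_Lp_int f g A : {ae mu, forall t, f t = g t} ->
  Lp_int p f A = Lp_int p g A.
Proof.
move=> fg; apply/eqP; rewrite eq_le; apply/andP.
by split; apply: ae_le_Lp_int; apply: ae_imp fg => t ->.
Qed.

Lemma simple_limit_powR_measurable f : simple_limit f ->
  measurable_fun setT (fun t => (`|f t| `^ p)%:E).
Proof.
move=> sf; apply/measurable_EFinP.
apply: (measurableT_comp (measurable_powR p)).
exact: simple_limit_measurable.
Qed.

Lemma Lp_intD_le f g h (c : R) A : measurable A -> 0 <= c ->
  strongly_measurable f -> strongly_measurable g ->
  {ae mu, forall t, A t -> `|h t| `^ p <= c * (`|f t| `^ p + `|g t| `^ p)} ->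
  (Lp_int p h A <= c%:E * (Lp_int p f A + Lp_int p g A))%E.
Proof.
move=> mA c0 /strongly_measurable_version[f0 sf ff] /strongly_measurable_version[g0 sg gg].
rewrite (ae_eq_Lp_int _ ff) (ae_eq_Lp_int _ gg) => hfg.
have mf := measurable_funTS (D := A) (simple_limit_powR_measurable sf).
have mg := measurable_funTS (D := A) (simple_limit_powR_measurable sg).
rewrite /Lp_int -ge0_integralD//; try by move=> x _; rewrite lee_fin powR_ge0.
rewrite -ge0_integralZl//; last 2 first.
- exact: emeasurable_funD.
- by move=> x _; rewrite -EFinD lee_fin addr_ge0 ?powR_ge0.
apply: ae_le_lower_integral => [x|x|].
- by rewrite lee_fin powR_ge0.
- by rewrite -EFinD -EFinM lee_fin mulr_ge0// addr_ge0 ?powR_ge0.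
apply: ae_imp2 hfg (ae_imp2 (fun t a b => conj a b) ff gg) => t + [ft gt] At => /(_ At).
by rewrite -EFinD -EFinM lee_fin ft gt.
Qed.

(** Since x + y is at most twice the maximum. The constant 2^p, named [A] in later proofs, is the
    price of this quasi-triangle inequality, which replaces Minkowski throughout. *)
Lemma powR_addr_le (x y : R) : 0 <= p -> 0 <= x -> 0 <= y ->
  (x + y) `^ p <= 2 `^ p * (x `^ p + y `^ p).
Proof.
move=> p0 x0 y0; apply: (@le_trans _ _ ((2 * Num.max x y) `^ p)).
  apply: ge0_ler_powR; rewrite ?nnegrE ?mulr_ge0 ?addr_ge0 ?le_max ?x0//.
  rewrite mulr_natl mulr2n.
  by apply: lerD; rewrite le_max lexx ?orbT.
rewrite powRM ?le_max ?x0// ler_wpM2l ?powR_ge0//.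
by rewrite /Num.max; case: ifP => _; rewrite ?lerDl ?lerDr powR_ge0.
Qed.

Lemma Lp_int_triangle f g h A : 0 <= p -> measurable A ->
  strongly_measurable f -> strongly_measurable g ->
  (forall t, A t -> `|h t| <= `|f t| + `|g t|) ->
  (Lp_int p h A <= (2 `^ p)%:E * (Lp_int p f A + Lp_int p g A))%E.
Proof.
move=> p0 mA mf mg hfg; apply: Lp_intD_le; rewrite ?powR_ge0//.
apply: aeW => t At; apply: le_trans (powR_addr_le _ _ _) => //.
by apply: ge0_ler_powR; rewrite ?nnegrE ?addr_ge0//; exact: hfg.
Qed.

Lemma Lp_int_itv_split f (a b c : R) : a <= b -> b <= c -> strongly_measurable f ->
  Lp_int p f `[a, c] = (Lp_int p f `[a, b] + Lp_int p f `[b, c])%E.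
Proof.
move=> ab bc /strongly_measurable_version[f0 sf ff].
rewrite !(ae_eq_Lp_int _ ff).
have mf := simple_limit_powR_measurable sf.
have -> : Lp_int p f0 `[b, c] = Lp_int p f0 `]b, c].
  apply/esym; apply: integral_itv_obnd_cbnd; exact: measurable_funTS.
rewrite (_ : `[a, c]%classic = `[a, b] `|` `]b, c]); last first.
  by rewrite -itv_bndbnd_setU ?bnd_simp.
apply: ge0_integral_setU => //.
- exact: measurable_funTS.
apply/disj_setPLR => x /=; rewrite !in_itv/= => /andP[_ xb] /andP[bx _].
by move: bx; rewrite ltNge xb.
Qed.

Lemma Lp_int_itvoo f (a b : R) : Lp_int p f `[a, b] = Lp_int p f `]a, b[.
Proof.
apply/eqP; rewrite eq_le; apply/andP; split; last first.
  by apply: Lp_int_subset => x; exact: subset_itv_oo_cc.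
apply: ae_le_Lp_int.
exists ([set a] `|` [set b]); split; first exact: measurableU.
  by rewrite measureU0//= ?lebesgue_measure_set1.
move=> t /= H; apply: contrapT => /not_orP[/eqP ta /eqP tb]; apply: H.
rewrite !in_itv/= => /andP[at_ tb']; split => //.
by rewrite !lt_neqAle eq_sym ta at_ tb tb'.
Qed.

Lemma Lp_int_le_cst f (a b M : R) : 0 < p -> a <= b ->
  (forall t, a < t < b -> `|f t| <= M) ->
  (Lp_int p f `[a, b] <= (M `^ p * (b - a))%:E)%E.
Proof.
move=> p0 ab fM; rewrite Lp_int_itvoo.
apply: (@le_trans _ _ (\int[mu]_(t in `]a, b[) (M `^ p)%:E)%E).
  apply: ae_le_lower_integral => [x|x|]; rewrite ?lee_fin ?powR_ge0//.
  apply: aeW => t tab; split => //; rewrite lee_fin.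
  have /fM tM : a < t < b by move: tab; rewrite /= in_itv.
  by apply: ge0_ler_powR; rewrite ?nnegrE ?(ltW p0)//; apply: le_trans tM.
have -> : (\int[mu]_(t in `]a, b[) (M `^ p)%:E = (M `^ p)%:E * mu `]a, b[)%E.
  exact: integral_cst.
rewrite lebesgue_measure_itv/= lte_fin; case: ifP => _; first by rewrite EFinM EFinB.
by rewrite mule0 lee_fin mulr_ge0 ?powR_ge0 ?subr_ge0.
Qed.

(** Sums an estimate over m adjacent intervals of length d. The case [K] = 0 adds up constants
    only. *)
Lemma Lp_int_uniform_split f f' (a d K c : R) (m : nat) : 0 <= d -> 0 <= K ->
  strongly_measurable f -> strongly_measurable f' ->
  (forall i : nat, (i < m)%N ->
    let I := `[a + i%:R * d, a + i.+1%:R * d]%classic in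
    (Lp_int p f I <= K%:E * Lp_int p f' I + c%:E)%E) ->
  let J := `[a, a + m%:R * d]%classic in
  (Lp_int p f J <= K%:E * Lp_int p f' J + (m%:R * c)%:E)%E.
Proof.
move=> d0 K0 sf sf'; elim: m => [_|m IH H] /=.
  rewrite !mul0r addr0 adde0 Lp_int_itvoo set_itvoo0 /Lp_int integral_set0.
  by rewrite mule_ge0 ?lee_fin// Lp_int_ge0.
have h1 : a <= a + m%:R * d by rewrite lerDl mulr_ge0.
have h2 : a + m%:R * d <= a + m.+1%:R * d by rewrite lerD2l ler_wpM2r// ler_nat.
rewrite (Lp_int_itv_split h1 h2)// (Lp_int_itv_split h1 h2 sf').
apply: le_trans (leeD (IH _) (H m _)) _ => // [i im|]; first by apply: H; exact: ltnW.
have -> : (m.+1%:R * c = m%:R * c + c)%R by rewrite -natr1 mulrDl mul1r.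
by rewrite (ge0_muleDr _ (Lp_int_ge0 _ _) (Lp_int_ge0 _ _)) EFinD addeACA.
Qed.

End LpInt.

(** * Translation invariance *)

Section Shift.
Context {R : realType}.
Local Notation mu := (@lebesgue_measure R).
Implicit Type s : R.

Lemma measurable_shift s : measurable_fun setT (fun t : R => t + s).
Proof. exact: measurable_funD. Qed.

(** The pushforward under the shift agrees with Lebesgue measure on half-open intervals, hence
    everywhere by uniqueness. *)
Lemma lebesgue_measure_shift s (A : set R) : measurable A ->
  mu ((fun t => t + s) @^-1` A) = mu A.
Proof.
move=> mA; apply/esym.
apply: (@lebesgue_measure_unique R
  (pushforward mu (fun t : R => t + s : measurableTypeR R))) => //.
  exact: measurable_shift.
move=> mf _ [[a b] _ <-] /=; rewrite /pushforward.
have -> : (fun t => t + s) @^-1` `]a, b] = `]a - s, b - s]%classic.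
  by apply/seteqP; split => x /=; rewrite !in_itv/= ltrBlDr lerBrDr.
rewrite !lebesgue_measure_itv/= !lte_fin ltrD2r -!EFinB.
by case: ifP => // _; congr (_%:E); lra.
Qed.

Lemma ae_shift s (P : R -> Prop) :
  {ae mu, forall t, P t} -> {ae mu, forall t, P (t + s)}.
Proof.
move=> [N [mN N0 sN]]; exists ((fun t => t + s) @^-1` N); split.
- by rewrite -[X in measurable X]setTI; exact: measurable_shift.
- by rewrite lebesgue_measure_shift.
- by move=> t; exact: sN.
Qed.

Context {V : normedModType R}.
Implicit Type f : R -> V.

Lemma strongly_measurable_shift f s :
  strongly_measurable f -> strongly_measurable (fun t => f (t + s)).
Proof.
move=> [u [su uf]]; exists (fun n t => u n (t + s)); split => [n|].
  split; first by apply: sub_finite_set (su n).1 => _ [t _ <-]; exists (t + s).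
  move=> v; have := measurable_shift s measurableT ((su n).2 v).
  by rewrite setTI.
exact: (@ae_shift s (fun t => u ^~ t @ \oo --> f t)).
Qed.

Lemma Lp_int_shift p f s (a b : R) : strongly_measurable f ->
  Lp_int p (fun t => f (t + s)) `[a, b] = Lp_int p f `[a + s, b + s].
Proof.
move=> /strongly_measurable_version[f0 sf ff].
rewrite (ae_eq_Lp_int p _ ff) (ae_eq_Lp_int p _ (ae_shift s ff)).
transitivity (\int[pushforward mu ((fun t => t + s)%R :
  R -> measurableTypeR R)]_(t in `[(a + s)%R, (b + s)%R])
  (`|f0 t| `^ p)%:E)%E; last first.
  apply: eq_measure_integral => [|mf A mA _]; first exact: measurable_shift.
  exact: (lebesgue_measure_shift s mA).
rewrite ge0_integral_pushforward//.
- rewrite (_ : _ @^-1` _ = `[a, b]%classic)//.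
  by apply/seteqP; split => x /=; rewrite !in_itv/= !lerD2r.
- exact: measurable_shift.
- apply: measurable_funTS; exact: simple_limit_powR_measurable.
Qed.

End Shift.

(** * Step functions on a uniform grid *)

Section Step.
Context {R : realType} {V : normedModType R}.
Variable N : nat.
Local Notation n := (N.+1%:R : R).

(** Index j of the half-open grid cell [j/n, (j+1)/n) around t. The step 1/(N+1) is never
    degenerate, and every integer is a grid point. *)
Definition cell (t : R) : int := Num.floor (n * t).

Lemma cellP t (j : int) : (cell t == j) = (j%:~R / n <= t < (j + 1)%:~R / n).
Proof.
rewrite ler_pdivrMr// ltr_pdivlMr// ![t * _]mulrC; apply/eqP/idP.
  by move=> <-; rewrite /cell floor_itv.
by move=> H; apply: floor_def.
Qed.

Lemma measurable_cell (P : int -> Prop) : measurable [set t | P (cell t)].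
Proof.
pose F j : set R := if `[< P j >] then [set t : R | j%:~R / n <= t < (j + 1)%:~R / n] else set0.
have -> : [set t | P (cell t)] = \bigcup_j F j.
  apply/seteqP; split => [t Pt|t [j _]]; rewrite /F.
    by exists (cell t) => //; rewrite asboolT//= -cellP.
  by case: asboolP => // Pj /=; rewrite -cellP => /eqP->.
apply: countable_bigcupT_measurable => // j; rewrite /F; case: ifP => // _.
by rewrite (_ : mkset _ = `[j%:~R / n, (j + 1)%:~R / n[%classic).
Qed.

Lemma simple_fun_cell (w : int -> V) :
  finite_set (range w) -> simple_fun (fun t => w (cell t)).
Proof.
move=> fw; split; last by move=> v; exact: (measurable_cell (fun j => w j = v)).
by apply: sub_finite_set fw => _ [t _ <-]; exists (cell t).
Qed.

End Step.

Lemma finite_set_absz_le (m : nat) : finite_set [set j : int | (`|j| <= m)%N].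
Proof.
apply: (sub_finite_set _ (finite_image (fun k : nat => k%:Z - m%:Z) (finite_II (m.*2.+1)))).
move=> j /= jm; exists (absz (j + m%:Z)%R); rewrite /=; lia.
Qed.

Section Continuous.
Context {R : realType} {V : normedModType R}.

Lemma cell_dist (N : nat) (t : R) : 0 <= t - (cell N t)%:~R / N.+1%:R <= N.+1%:R^-1.
Proof.
have := cellP N t (cell N t); rewrite eqxx => /esym/andP[h1 h2].
rewrite subr_ge0 h1/= lerBlDl; apply: le_trans (ltW h2) _.
by rewrite intrD mulrDl mul1r.
Qed.

Lemma continuous_simple_limit (c : R -> V) : continuous c -> simple_limit c.
Proof.
move=> cc.
(* Sampling at the left ends of cells; the cut at |j| <= (n+1)^2 leaves finitely many values, while
   the window [-(n+1), n+1] still exhausts the line. *)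
pose w n (j : int) := if (`|j| <= n.+1 ^ 2)%N then c (j%:~R / n.+1%:R) else 0.
exists (fun n t => w n (cell n t)); split => [n|t].
  apply: simple_fun_cell.
  apply: (@sub_finite_set _ _ (0 |` (fun j : int => c (j%:~R / n.+1%:R)) @`
     [set j : int | (`|j| <= n.+1 ^ 2)%N])).
    move=> _ [j _ <-]; rewrite /w; case: ifPn => jn; [right|by left].
    by exists j.
  by rewrite finite_setU; split => //; exact/finite_image/finite_set_absz_le.
have cell_cvg : (fun n => (cell n t)%:~R / n.+1%:R) @ \oo --> t.
  apply/cvgrPdist_le => e e0.
  near=> n; have /andP[h1 h2] := cell_dist n t.
  rewrite ger0_norm//; apply: le_trans h2 _; apply: ltW; near: n.
  exact: near_infty_natSinv_lt (PosNum e0).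
have : (fun n => c ((cell n t)%:~R / n.+1%:R)) @ \oo --> c t.
  by apply: continuous_cvg => //; exact: cc.
apply: cvg_trans; apply: near_eq_cvg; near=> n; rewrite /w ifT//.
have /andP[h1 h2] := cell_dist n t.
have n0 : 0 < n.+1%:R :> R by rewrite ltr0n.
rewrite -lez_nat -(ler_int R) abszE intr_norm.
have -> : (cell n t)%:~R = n.+1%:R * ((cell n t)%:~R / n.+1%:R) :> R by rewrite mulrCA mulfV
  ?mulr1// gt_eqF.
rewrite normrM gtr0_norm// -[leRHS]/((n.+1 ^ 2)%:R) natrX expr2 ler_pM2l//.
apply: (@le_trans _ _ (`|t| + 1)); last first.
  rewrite -natr1 lerD2r; near: n; exact: nbhs_infty_ger.
rewrite -[X in `|X|](subKr t); apply: le_trans (ler_normB _ _) _.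
rewrite lerD2l ger0_norm//; apply: le_trans h2 _.
by rewrite invf_le1// ler1n.
Unshelve. all: by end_near.
Qed.

Lemma continuous_strongly_measurable (c : R -> V) : continuous c -> strongly_measurable c.
Proof.
move=> cc; exact: simple_limit_strongly_measurable (continuous_simple_limit cc) (aeW _ (fun=>
  erefl)).
Qed.

End Continuous.

(** * Smooth steps *)

Section SmoothStep.
Context {R : realType}.

Fixpoint Cn (n : nat) (f : R -> R) : Prop :=
  if n is m.+1 then (forall x : R, derivable f x 1) /\ Cn m (derive1 f) else True.

Lemma CnW n f : Cn n.+1 f -> Cn n f.
Proof. by elim: n f => [//|n IH] f [df /= Cf]; split => //; exact: IH. Qed.

Lemma derive1_funE (f g : R -> R) : (forall x : R, is_derive x 1 f (g x)) -> derive1 f = g.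
Proof. by move=> H; apply/funext => x; rewrite derive1E;
  exact: (@derive_val _ _ _ _ _ _ _ (H x)). Qed.

Lemma Cn_is_derive n f : Cn n.+1 f -> forall x : R, is_derive x 1 f (derive1 f x).
Proof. by move=> [df _] x; rewrite derive1E; exact: derivableP. Qed.

Lemma CnS n f g : (forall x : R, is_derive x 1 f (g x)) -> Cn n g -> Cn n.+1 f.
Proof. by move=> H Cg; split; [move=> x;
  exact: (@ex_derive _ _ _ _ _ _ _ (H x))|rewrite (derive1_funE H)]. Qed.

Lemma CnD n f g : Cn n f -> Cn n g -> Cn n (fun x => f x + g x).
Proof.
elim: n f g => [//|n IH] f g Cf Cg.
apply: (@CnS _ _ (fun x => derive1 f x + derive1 g x)); last by apply: IH;
  [exact: Cf.2|exact: Cg.2].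
move=> x; exact: (is_deriveD (Cn_is_derive Cf x) (Cn_is_derive Cg x)).
Qed.

Lemma Cn_cst n (a : R) : Cn n (fun=> a).
Proof.
elim: n a => [//|n IH] a; apply: (@CnS _ _ (fun=> 0)) => // x; exact: is_derive_cst.
Qed.

Lemma CnM n f g : Cn n f -> Cn n g -> Cn n (fun x => f x * g x).
Proof.
elim: n f g => [//|n IH] f g Cf Cg.
apply: (@CnS _ _ (fun x => f x * derive1 g x + g x * derive1 f x)); last first.
  by apply: CnD; apply: IH; first [exact: CnW | exact: Cf.2 | exact: Cg.2].
move=> x; exact: (is_deriveM (Cn_is_derive Cf x) (Cn_is_derive Cg x)).
Qed.

Lemma CnV n f : (forall x : R, f x != 0) -> Cn n f -> Cn n (fun x => (f x)^-1).
Proof.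
move=> f0; elim: n => [//|n IH] Cf.
apply: (@CnS _ _ (fun x => (-1) * ((f x)^-1 * (f x)^-1) * derive1 f x)); last first.
  by apply: CnM; [apply: CnM; [exact: Cn_cst|apply: CnM; apply: IH; exact: CnW]|exact: Cf.2].
move=> x; apply: is_derive_eq (is_deriveV (f0 x) (Cn_is_derive Cf x)) _.
by rewrite /GRing.scale/= mulN1r -exprVn expr2.
Qed.

Lemma Cn_affine n f (a b : R) : Cn n f -> Cn n (fun x => f (a * x + b)).
Proof.
elim: n f => [//|n IH] f Cf.
apply: (@CnS _ _ (fun x => derive1 f (a * x + b) * a)); last by apply: CnM; [apply: IH;
  exact: Cf.2|exact: Cn_cst].
move=> x.
have dab : is_derive x 1 (fun y : R => a * y + b) a.
  have -> : (fun y : R => a * y + b) = a \*: (id : R -> R) + cst b by [].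
  by apply: is_derive_eq; rewrite /GRing.scale/= mulr1 addr0.
exact: (@is_derive1_comp _ f (fun y : R => a * y + b) _ _ _ (Cn_is_derive Cf (a * x + b)) dab).
Qed.

(* P(1/x) exp(-1/x) for x > 0; these functions are stable under derivation, P becoming
   X^2 (P - P'). *)
Definition flat (P : {poly R}) (x : R) : R :=
  if 0 < x then P.[x^-1] * expR (- x^-1) else 0.

(** From y^i <= i! e^y, applied to each monomial; this explains the factorials in [C]. *)
Lemma poly_exp_decay (P : {poly R}) : exists2 C, 0 <= C &
  forall y, 0 <= y -> `|P.[y]| * expR (- y) <= C.
Proof.
pose C := \sum_(i < size P) `|P`_i| * (i`!)%:R.
exists C; first by apply: sumr_ge0 => i _; rewrite mulr_ge0.
move=> y y0; rewrite expRN -ler_pdivlMr ?invr_gt0 ?expR_gt0// invrK horner_coef.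
apply: le_trans (ler_norm_sum _ _ _) _; rewrite /C mulr_suml; apply: ler_sum => i _.
rewrite normrM -mulrA ler_wpM2l// normrX ger0_norm//.
rewrite -ler_pdivrMl ?ltr0n ?fact_gt0// mulrC.
case: (val i) => [|k]; first by rewrite expr0 fact0 divr1 -expR0 ler_expR.
by apply: le_trans (expR_ge1Dxn k y0); rewrite lerDr.
Qed.

Definition dflat (P : {poly R}) : {poly R} := 'X^2 * (P - P^`()).

Lemma is_derive_flat_pos (P : {poly R}) (x : R) : 0 < x ->
  is_derive x 1 (flat P) (flat (dflat P) x).
Proof.
move=> x0.
have xn0 : x != 0 by rewrite gt_eqF.
have dV : is_derive x 1 (fun y : R => y^-1) (- x ^- 2).
  by apply: is_derive_eq (is_deriveV (f := id) xn0 (is_derive_id _ _)) _;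
    rewrite /GRing.scale/= mulr1.
have dP : is_derive x^-1 1 (horner P) (P^`().[x^-1]).
  by split; [exact: derivable_horner|rewrite -derive1E derivE].
have d1 : is_derive x 1 (fun y : R => P.[y^-1]) (P^`().[x^-1] * (- x ^- 2)).
  exact: (@is_derive1_comp _ (horner P) (fun y : R => y^-1)).
have d2 : is_derive x 1 (fun y : R => expR (- y^-1)) (expR (- x^-1) * (- - x ^- 2)).
  exact: (@is_derive1_comp _ expR (fun y : R => - y^-1)).
have d3 := is_deriveM d1 d2.
apply: (@near_eq_is_derive _ _ _ ((fun y : R => P.[y^-1]) * (fun y : R => expR (- y^-1)))).
  near=> y; rewrite /flat ifT//.
  near: y; exact: lt_nbhsr.
apply: is_derive_eq d3 _; rewrite /flat x0 /dflat !hornerE /GRing.scale/= -exprVn.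
ring.
Unshelve. all: by end_near. Qed.

(** The bound at h = 0 forces f 0 = 0, and then the difference quotient is at most C |h|. *)
Lemma is_derive0_quadratic (f : R -> R) (C : R) : (forall h, `|f h| <= C * h ^+ 2) ->
  is_derive (0 : R) 1 f 0.
Proof.
move=> bnd.
have f00 : f 0 = 0 by apply/eqP; rewrite -normr_le0; have := bnd 0; rewrite expr0n mulr0.
have C0 : 0 <= C by have := bnd 1; rewrite expr1n mulr1; apply: le_trans.
have H : (fun h : R => h^-1 *: ((f \o shift 0) (h *: 1) - f 0)) @ 0^' --> (0 : R).
  apply/cvgr0Pnorm_le => e e0; near=> h.
  rewrite /= /GRing.scale/= mulr1 addr0 f00 subr0 normrM normfV.
  have h0 : h != 0 by near: h; exact: nbhs_dnbhs_neq.
  rewrite mulrC ler_pdivrMr ?normr_gt0//.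
  apply: le_trans (bnd h) _; rewrite -real_normK ?num_real// expr2 mulrA.
  rewrite ler_wpM2r//; apply: (@le_trans _ _ ((C + 1) * `|h|)).
    by rewrite ler_wpM2r// lerDl.
  rewrite -ler_pdivlMl ?ltr_wpDl//.
  near: h; apply: dnbhs0_le; rewrite mulr_gt0// invr_gt0 ltr_wpDl//.
by apply: DeriveDef; [apply: cvgP H|exact: cvg_lim H].
Unshelve. all: by end_near. Qed.

Lemma is_derive_flat (P : {poly R}) (x : R) : is_derive x 1 (flat P) (flat (dflat P) x).
Proof.
have [x0|x0|<-] := ltgtP 0 x; first exact: is_derive_flat_pos.
  apply: (@near_eq_is_derive _ _ _ (cst 0)).
    near=> y; rewrite /flat ifF//; apply/negbTE; rewrite -leNgt ltW//.
    by near: y; exact: lt_nbhsl.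
  by rewrite /flat ltNge (ltW x0)/=; exact: is_derive_cst.
rewrite [in X in is_derive _ _ _ X]/flat ltxx.
(* The extra X^2, evaluated at 1/h, turns decay into the quadratic bound |flat P h| <= C h^2. *)
have [C C0 HC] := poly_exp_decay ('X^2 * P).
apply: (@is_derive0_quadratic _ C) => h.
rewrite /flat; case: ifPn => h0; last by rewrite normr0 mulr_ge0 ?sqr_ge0.
have := HC h^-1 (ltW _); rewrite invr_gt0 => /(_ h0).
rewrite !hornerE normrM exprVn normfV normrX (gtr0_norm h0) normrM (ger0_norm (expR_ge0 _)).
by rewrite -mulrA ler_pdivrMl ?exprn_gt0// expr2 [_ * C]mulrC mulrA.
Unshelve. all: by end_near. Qed.

Lemma Cn_flat n P : Cn n (flat P).
Proof.
elim: n P => [//|n IH] P; exact: (CnS (is_derive_flat P)).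
Qed.

(** The classical quotient; its denominator is positive because x and 1 - x are never both
    nonpositive. *)
Definition smooth_step (x : R) : R := flat 1 x / (flat 1 x + flat 1 (1 - x)).

Lemma flat1_ge0 (x : R) : 0 <= flat 1 x.
Proof. by rewrite /flat; case: ifP => // _; rewrite hornerC mul1r expR_ge0. Qed.

Lemma flat1_gt0 (x : R) : 0 < x -> 0 < flat 1 x.
Proof. by rewrite /flat => ->; rewrite hornerC mul1r expR_gt0. Qed.

Lemma smooth_step_denom (x : R) : flat 1 x + flat 1 (1 - x) != 0.
Proof.
rewrite gt_eqF//; have [x0|x0] := ltP 0 x.
  by rewrite ltr_pwDl// ?flat1_gt0 ?flat1_ge0.
by rewrite ltr_wpDl ?flat1_gt0 ?flat1_ge0//; lra.
Qed.

Lemma Cn_smooth_step n : Cn n smooth_step.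
Proof.
apply: CnM; first exact: Cn_flat.
apply: CnV; first exact: smooth_step_denom.
apply: CnD; first exact: Cn_flat.
have -> : (fun x : R => flat 1 (1 - x)) = (fun x : R => flat 1 (-1 * x + 1)).
  by apply/funext => x; congr flat; ring.
by apply: Cn_affine; exact: Cn_flat.
Qed.

Lemma smooth_step_le0 (x : R) : x <= 0 -> smooth_step x = 0.
Proof. by move=> x0; rewrite /smooth_step {1}/flat ltNge x0 mul0r. Qed.

Lemma smooth_step_ge1 (x : R) : 1 <= x -> smooth_step x = 1.
Proof.
move=> x1; rewrite /smooth_step.
have -> : flat 1 (1 - x) = 0 by rewrite /flat; case: ifP => //; lra.
by rewrite addr0 divff// gt_eqF// flat1_gt0//; lra.
Qed.

Lemma smooth_step_itv (x : R) : 0 <= smooth_step x <= 1.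
Proof.
have d := smooth_step_denom x.
have d0 : 0 < flat 1 x + flat 1 (1 - x) by rewrite lt_neqAle eq_sym d addr_ge0// flat1_ge0.
rewrite /smooth_step divr_ge0 ?flat1_ge0 ?(ltW d0)//= ler_pdivrMr// mul1r lerDl.
exact: flat1_ge0.
Qed.

End SmoothStep.

Section Derivatives.
Context {R : realType} {V : normedModType R}.

Lemma is_derive_scale_vec (f : R -> R) (v : V) (t d : R) :
  is_derive t 1 f d -> is_derive t 1 (fun s => f s *: v) (d *: v).
Proof.
move=> [df <-].
have H : (fun h : R => h^-1 *: (((fun s => f s *: v) \o shift t) (h *: 1) - f t *: v)) @ 0^' -->
    'D_1 f t *: v.
  rewrite (_ : (fun h => _) = (fun h : R => (h^-1 *: ((f \o shift t) (h *: 1) - f t)) *: v));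
    last first.
    by apply/funext => h /=; rewrite -scalerBl scalerA.
  by apply: cvgZr_tmp; exact: df.
by apply: DeriveDef; [apply: cvgP H|exact: cvg_lim H].
Qed.

Lemma derive1n_family (G : nat -> R -> V) :
  (forall k (t : R), is_derive t 1 (G k) (G k.+1 t)) -> forall k, derive1n k (G 0%N) = G k.
Proof.
move=> H; elim=> [//|k IH]; rewrite derive1nS IH; apply/funext => t.
by rewrite derive1E; exact: (@derive_val _ _ _ _ _ _ _ (H k t)).
Qed.

(** Lets smoothness be checked on an explicit sequence of candidate derivatives, which can be given
    cell by cell, instead of on iterated [derive1]. *)
Lemma Cinf_b_family (G : nat -> R -> V) :
  (forall k (t : R), is_derive t 1 (G k) (G k.+1 t)) ->
  (forall k, exists M : R, forall t, `|G k t| <= M) -> Cinf_b (G 0%N).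
Proof.
move=> H bG k; rewrite (derive1n_family H).
have dG t : derivable (G k) t 1 by exact: (@ex_derive _ _ _ _ _ _ _ (H k t)).
split=> //; split; last exact: bG.
by move=> t; apply: differentiable_continuous; apply/derivable1_diffP.
Qed.

End Derivatives.

Section Transition.
Context {R : realType}.

Lemma Cn_derive1n (f : R -> R) : (forall n, Cn n f) -> forall k n, Cn n (derive1n k f).
Proof. by move=> Cf; elim=> [//|k IH] n; exact: (IH n.+1).2. Qed.

Lemma derive1n_near_cst (f : R -> R) (a : R) k (x : R) :
  (\forall y \near x, f y = a) -> \forall y \near x, derive1n k f y = if k is 0%N then a else 0.
Proof.
move=> fa; elim: k => [//|k IH]; rewrite derive1nS.
(* The function is constant near every point y close to x, so its derivative can be computed at all
   these y. *)
have := near_join IH; apply: filterS => y Hy.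
rewrite derive1E (@near_eq_derive _ _ _ _ (cst (if k is 0%N then a else 0)))//.
exact: derive_cst.
Qed.

(* [th k] is the k-th derivative of a smooth transition from 0 to 1 on [0, eta]. *)
Lemma smooth_transition (eta : R) : 0 < eta -> exists th : nat -> R -> R,
  [/\ forall k (x : R), is_derive x 1 (th k) (th k.+1 x),
      forall k x, x < 0 -> th k x = 0,
      forall k x, eta < x -> th k x = (k == 0%N)%:R,
      forall x, 0 <= th 0%N x <= 1 &
      forall k, exists M, forall x, `|th k x| <= M].
Proof.
move=> e0; pose f x := smooth_step (eta^-1 * x + 0).
have Cf n : Cn n f by apply: Cn_affine; exact: Cn_smooth_step.
have d k (x : R) : is_derive x 1 (derive1n k f) (derive1n k.+1 f x).
  exact: (Cn_is_derive (Cn_derive1n Cf k 1%N)).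
have neg k x : x < 0 -> derive1n k f x = 0.
  move=> x0; have : \forall y \near x, f y = 0.
    near=> y; apply: smooth_step_le0; rewrite addr0 pmulr_rle0 ?invr_gt0// ltW//.
    by near: y; exact: lt_nbhsl.
  by move=> /(@derive1n_near_cst _ _ k)/nbhs_singleton ->; case: k.
have pos k x : eta < x -> derive1n k f x = (k == 0%N)%:R.
  move=> x0; have : \forall y \near x, f y = 1.
    near=> y; apply: smooth_step_ge1; rewrite addr0 ler_pdivlMl// mulr1 ltW//.
    by near: y; exact: lt_nbhsr.
  by move=> /(@derive1n_near_cst _ _ k)/nbhs_singleton ->; case: k.
exists (fun k => derive1n k f); split => //.
  by move=> x; exact: smooth_step_itv.
move=> k.
have cf : continuous (derive1n k f).
  move=> x; apply: differentiable_continuous; apply/derivable1_diffP.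
  exact: (@ex_derive _ _ _ _ _ _ _ (d k x)).
have cn : {within `[0, eta], continuous (fun x => `|derive1n k f x|)}.
  by apply: continuous_subspaceT => x; apply: continuous_comp; [exact: cf|exact: norm_continuous].
have [c _ cM] := EVT_max (ltW e0) cn.
(* The 1 covers x > eta, where the transition itself (k = 0) equals 1; the other entry is the
   maximum on [0, eta]. *)
exists (Num.max 1 `|derive1n k f c|) => x; rewrite le_max.
have [x0|x0] := ltP x 0; first by rewrite neg// normr0 ler01.
have [ex|xe] := ltP eta x; last by rewrite cM ?orbT// in_itv/= x0.
by rewrite pos//; case: (k == 0%N); rewrite ?normr1 ?normr0 ?ler01 ?lexx.
Unshelve. all: by end_near. Qed.

End Transition.

Section SmoothedStep.
Context {R : realType} {V : normedModType R}.
Variables (N : nat) (w : int -> V) (B : R).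
Local Notation n := (N.+1%:R : R).
Hypothesis wB : forall j, `|w j| <= B.

(** The jump from w (j-1) to w j is spread over the first eta of cell j. As eta < 1/n it is over
    before the cell ends, so the formulas of adjacent cells agree near the common endpoint. *)
Lemma smoothed_step (eta : R) : 0 < eta -> eta < n^-1 -> exists G : R -> V,
  [/\ Cinf_b G, forall t, `|G t - w (cell N t)| <= 2 * B &
    forall t, eta < t - (cell N t)%:~R / n -> G t = w (cell N t)].
Proof.
move=> e0 en; have [th [dth th_neg th_pos th01 thM]] := smooth_transition e0.
(* [F k j] is the k-th derivative of the formula for cell j; the additive constant survives only for
   k = 0. *)
pose F k j t := (if k is 0%N then w (j - 1) else 0) + th k (t - j%:~R / n) *: (w j - w (j - 1)).
pose G k t := F k (cell N t) t.
have B2 j : `|w j - w (j - 1)| <= 2 * B.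
  by apply: le_trans (ler_normB _ _) _; rewrite mulr_natl mulr2n lerD.
have aux (x y z t : R) : x - (y - z) < t -> z < t - (x - y) by lra.
(* The formula of the cell of t0 is also valid slightly to its left: there the previous transition
   is complete and the present one has not begun. *)
have GF k (t0 : R) : \forall t \near t0, F k (cell N t0) t = G k t.
  have := cellP N t0 (cell N t0); rewrite eqxx => /esym/andP[h1 h2].
  near=> t.
  have t2 : t < (cell N t0 + 1)%:~R / n by near: t; exact: lt_nbhsl.
  have t1 : (cell N t0)%:~R / n - (n^-1 - eta) < t.
    by near: t; apply: lt_nbhsr; rewrite ltrBlDr ltr_pwDr// subr_gt0.
  rewrite /G; have [h|h] := leP ((cell N t0)%:~R / n) t.
    by congr F; apply/esym/eqP; rewrite cellP h.
  have -> : cell N t = cell N t0 - 1.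
    apply/eqP; rewrite cellP subrK h andbT intrB mulrBl mul1r ltW//.
    by apply: le_lt_trans t1; rewrite lerD2l lerN2 gerBl ltW.
  rewrite /F th_neg ?subr_lt0// scale0r addr0 th_pos; last first.
    by move: t1; rewrite intrB mulrBl mul1r; exact: aux.
  by case: k => [|k]; rewrite /= ?scale0r ?addr0// scale1r [RHS]addrC subrK.
have dG k (t : R) : is_derive t 1 (G k) (G k.+1 t).
  apply: (near_eq_is_derive (GF k t)).
  have ds : is_derive t 1 (fun y : R => y - (cell N t)%:~R / n) 1.
    have -> : (fun y : R => y - (cell N t)%:~R / n) = (id :
      R -> R) - cst ((cell N t)%:~R / n) by [].
    by apply: is_derive_eq; rewrite subr0.
  have d1 := is_derive_cst (if k is 0%N then w (cell N t - 1) else 0) t 1.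
  have d2 := is_derive_scale_vec (w (cell N t) - w (cell N t - 1))
    (@is_derive1_comp _ (th k) (fun y : R => y - (cell N t)%:~R / n) _ _ _ (dth k _) ds).
  by apply: is_derive_eq (is_deriveD d1 d2) _; rewrite mulr1.
exists (G 0%N); split.
- apply: Cinf_b_family => // k; have [M HM] := thM k.
  exists (B + M * (2 * B)) => t; rewrite /G /F; apply: le_trans (ler_normD _ _) _.
  apply: lerD; first by case: k {HM}; rewrite ?normr0// => *; apply: le_trans (wB 0).
  by rewrite normrZ ler_pM.
- move=> t; rewrite /G /F addrAC -[X in X + _]opprB -scaleN1r -scalerDl normrZ.
  rewrite -[leRHS]mul1r ler_pM// ?ler_norml//.
  by have /andP[] := th01 (t - (cell N t)%:~R / n); lra.
- by move=> t te; rewrite /G /F th_pos// scale1r [LHS]addrC subrK.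
Unshelve. all: by end_near. Qed.

End SmoothedStep.

(** * Mean value inequality and finite-dimensional nets *)

Section MeanValue.
Context {R : realType} {V : normedModType R}.

Lemma derivable_near_lip (f : R -> V) (c M : R) : derivable f c 1 -> `|derive1 f c| < M ->
  \forall h \near 0^'+, `|f (c + h) - f c| <= M * h.
Proof.
move=> df dM; rewrite derive1E in dM.
have dr := cvg_dnbhs_at_right df.
near=> h.
have : `|h^-1 *: ((f \o shift c) (h *: 1) - f c)| < M by near: h; exact: cvgr_norm_lt dr _ dM.
have h0 : 0 < h by near: h; exact: nbhs_right_gt.
rewrite normrZ normfV gtr0_norm// ltr_pdivrMl// /GRing.scale/= mulr1 [h + c]addrC mulrC.
exact: ltW.
Unshelve. all: by end_near. Qed.

(* The last point where the bound with slope M + e holds cannot lie before b. *)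
Lemma mean_value_le (f : R -> V) (M a b : R) : a <= b ->
  (forall x : R, derivable f x 1) -> (forall x, `|derive1 f x| <= M) ->
  `|f b - f a| <= M * (b - a).
Proof.
move=> ab df fM.
have cf : continuous f by move=> x; apply: differentiable_continuous; apply/derivable1_diffP.
apply/ler_addgt0Pr => e e0.
(* The added 1 keeps the denominator positive when a = b. *)
pose e' := e / (b - a + 1).
have e'0 : 0 < e' by rewrite divr_gt0// ltr_wpDl// subr_ge0.
suff : `|f b - f a| <= (M + e') * (b - a).
  move=> H; apply: le_trans H _; rewrite mulrDl lerD2l /e' -mulrA ler_piMr ?(ltW e0)//.
  by rewrite mulrC ler_pdivrMr ?ltr_wpDl ?subr_ge0// mul1r lerDl.
pose phi t := `|f t - f a| - (M + e') * (t - a).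
have cphi : continuous phi.
  move=> t; apply: cvgB.
    by apply: cvg_norm; apply: cvgB; [exact: cf|exact: cvg_cst].
  by apply: cvgM; [exact: cvg_cst|apply: cvgB; [exact: cvg_id|exact: cvg_cst]].
pose A := `[a, b] `&` (phi @^-1` [set x | x <= 0]).
have cA : compact A.
  apply: (subclosed_compact _ (@segment_compact _ a b)); last exact: subIsetl.
  apply: closedI; first exact: interval_closed.
  by apply: closed_comp => [x _|]; [exact: cphi|exact: closed_le].
have A0 : A !=set0.
  by exists a; split; rewrite /= ?in_itv/= ?lexx// /phi !subrr normr0 mulr0 subr0.
have [c cA' cmax] := compact_EVT_max A0 cA (continuous_subspaceT (fun x => @cvg_id _ (nbhs x))).
move: cA'; rewrite inE => -[]/=; rewrite in_itv/= => /andP[ac cb] phic.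
have [cb'|bc] := ltP c b; last first.
  by rewrite -subr_le0; have -> : b = c by apply/eqP; rewrite eq_le bc cb.
exfalso.
have MM : M < M + e' by rewrite ltrDl.
have near0 := derivable_near_lip (df c) (le_lt_trans (fM c) MM).
near (0 : R)^'+ => h.
have h0 : 0 < h by near: h; exact: nbhs_right_gt.
have hb : h <= b - c by near: h; apply: nbhs_right_le; rewrite subr_gt0.
have hl : `|f (c + h) - f c| <= (M + e') * h by near: h.
have : c + h \in A.
  rewrite inE /A; split => /=; first by rewrite in_itv/=; apply/andP; split; lra.
  rewrite /phi subr_le0; have -> : f (c + h) - f a = (f (c + h) - f c) + (f c - f a).
    by rewrite addrA subrK.
  apply: le_trans (ler_normD _ _) _.
  have := phic; rewrite /phi subr_le0 => phic'.
  have -> : (M + e') * (c + h - a) = (M + e') * h + (M + e') * (c - a) by ring.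
  exact: lerD.
by move=> /cmax; rewrite gerDl leNgt h0.
Unshelve. all: by end_near. Qed.

End MeanValue.

Section FiniteDim.
Context {R : realType} {V : normedModType R}.

Lemma cvg_sum_seq (T : Type) (A : set_system T) {FA : Filter A} n (f : 'I_n -> T -> V) (l :
  'I_n -> V) :
  (forall i, f i @ A --> l i) -> (fun t => \sum_(i < n) f i t) @ A --> \sum_(i < n) l i.
Proof.
elim: n f l => [|n IH] f l fl.
  by under eq_fun do rewrite big_ord0; rewrite big_ord0; exact: cvg_cst.
by under eq_fun do rewrite big_ord_recl; rewrite big_ord_recl; apply: cvgD; [exact: fl|exact: IH].
Qed.

(** The norm of the combination is continuous on the compact unit sphere of coefficients, and
    independence makes its minimum positive. The inverse of the minimum is the constant. *)
Lemma indep_coef_bound n (e : 'I_n -> V) :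
  (forall c : 'I_n -> R, \sum_i c i *: e i = 0 -> forall i, c i = 0) ->
  exists2 C : R, 0 <= C & forall (c : 'I_n -> R) i, `|c i| <= C * `|\sum_i c i *: e i|.
Proof.
case: n e => [|n] e ind; first by exists 0 => // c [].
pose L (v : 'rV[R]_n.+1) : R := `|\sum_i v 0 i *: e i|.
have cL : continuous L.
  have cs : continuous (fun v : 'rV[R]_n.+1 => \sum_i v 0 i *: e i).
    move=> v; apply: (@cvg_sum_seq _ (nbhs v) (nbhs_filter v) _ (fun i (v :
      'rV[R]_n.+1) => v 0 i *: e i)) => i.
    by apply: cvgZr_tmp; exact: coord_continuous.
  by move=> v; exact: cvg_norm (cs v).
pose S := [set v : 'rV[R]_n.+1 | `|v| = 1].
have cS : compact S.
  apply: bounded_closed_compact.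
    by exists 1; split => // x x1 v /= ->; exact: ltW.
  rewrite (_ : S = (fun v => `|v|) @^-1` [set 1])//.
  by apply: closed_comp => [x _|]; [exact: norm_continuous|exact: closed_eq].
have S0 : S !=set0.
  have nz : (const_mx 1 : 'rV[R]_n.+1) != 0.
    by apply/eqP => /rowP/(_ ord0)/eqP; rewrite !mxE oner_eq0.
  exists (`|const_mx 1 : 'rV[R]_n.+1|^-1 *: const_mx 1);
    rewrite /S/= normrZ normfV normr_id mulVf//.
  by rewrite normr_eq0.
have [v0 v0S vmin] := compact_EVT_min S0 cS (continuous_subspaceT cL).
have L0 : 0 < L v0.
  rewrite lt_neqAle eq_sym normr_ge0 andbT; apply/negP => /eqP/normr0_eq0 /ind z.
  have v00 : v0 = 0 by apply/rowP => i; rewrite z mxE.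
  by move: v0S; rewrite inE /S/= v00 normr0 => /eqP; rewrite eq_sym oner_eq0.
exists (L v0)^-1; first by rewrite invr_ge0 ltW.
move=> c i; pose v : 'rV[R]_n.+1 := \row_i c i.
have ci : `|c i| <= `|v|.
  have -> : c i = v 0 i by rewrite mxE.
  have -> : `|v| = mx_norm v by [].
  rewrite mx_normrE.
  exact: (le_bigmax _ (fun ij : 'I_1 * 'I_n.+1 => `|v ij.1 ij.2|) (0, i)).
rewrite ler_pdivlMl//; have -> : \sum_i c i *: e i = \sum_i v 0 i *: e i.
  by apply: eq_bigr => j _; rewrite mxE.
have [vz|vnz] := eqVneq `|v| 0.
  by have := ci; rewrite vz normr_le0 => /eqP->; rewrite normr0 mulr0.
have /vmin : `|v|^-1 *: v \in S.
  by rewrite inE /S/= normrZ normfV normr_id mulVf.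
have -> : L (`|v|^-1 *: v) = `|v|^-1 * `|\sum_i v 0 i *: e i|.
  rewrite /L -[X in X * _]ger0_norm ?invr_ge0// -normrZ scaler_sumr; congr `|_|.
  by apply: eq_bigr => j _; rewrite scalerA [(_ *: v) _ _]mxE.
have vgt0 : 0 < `|v| by rewrite lt_neqAle eq_sym vnz normr_ge0.
rewrite ler_pdivlMl//; apply: le_trans; rewrite [leRHS]mulrC.
by apply: ler_wpM2l => //; exact: ltW.
Qed.

(* The family e may be dependent: a vanishing combination lets one drop a vector. *)
Lemma coef_bound n (e : 'I_n -> V) : exists2 C : R, 0 <= C &
  forall c : 'I_n -> R, exists2 c' : 'I_n -> R,
    \sum_i c' i *: e i = \sum_i c i *: e i & forall i, `|c' i| <= C * `|\sum_i c i *: e i|.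
Proof.
elim: n e => [|n IH] e; first by exists 0 => // c; exists c => // -[].
have [ind|] := pselect (forall c : 'I_n.+1 -> R, \sum_i c i *: e i = 0 -> forall i, c i = 0).
  have [C C0 HC] := indep_coef_bound ind; exists C => // c; exists c => //.
move=> /existsNP[d /not_implyP[d0 /existsNP[i0 di0]]].
have [C C0 HC] := IH (e \o lift i0); exists C => // c.
pose r := c i0 / d i0.
have cE : \sum_i c i *: e i = \sum_(j < n) (c (lift i0 j) - r * d (lift i0 j)) *: e (lift i0 j).
  have -> : \sum_i c i *: e i = \sum_i (c i - r * d i) *: e i.
    transitivity (\sum_i c i *: e i - r *: \sum_i d i *: e i); first by rewrite d0 scaler0 subr0.
    by rewrite scaler_sumr -sumrB; apply: eq_bigr => i _; rewrite scalerA scalerBl.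
  rewrite (bigD1_ord i0)//= /r divfK ?subrr ?scale0r ?add0r//; exact/eqP.
have [c' c'E c'b] := HC (fun j => c (lift i0 j) - r * d (lift i0 j)).
exists (fun i => if unlift i0 i is Some j then c' j else 0).
  rewrite (bigD1_ord i0)//= unlift_none scale0r add0r cE -c'E.
  by apply: eq_bigr => j _; rewrite liftK.
move=> i; rewrite cE; case: unliftP => [j _|_]; first exact: c'b.
by rewrite normr0 mulr_ge0.
Qed.

(** Coefficients that are bounded by [coef_bound] are rounded down to multiples of [del]; the error
    is at most del times the sum of the |e_i|, hence at most eps. *)
Lemma span_bounded_net n (e : 'I_n -> V) (B eps : R) : 0 < eps -> exists F : seq V,
  forall c : 'I_n -> R, `|\sum_i c i *: e i| <= B ->
    exists2 y, y \in F & `|\sum_i c i *: e i - y| <= eps.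
Proof.
move=> e0; have [C C0 HC] := coef_bound e.
pose E := \sum_i `|e i| + 1.
have E0 : 0 < E by rewrite ltr_wpDl// sumr_ge0.
pose del := eps / E.
have del0 : 0 < del by rewrite divr_gt0.
pose K := (Num.bound (C * `|B| / del)).+1.
pose y (k : {ffun 'I_n -> 'I_(K.*2.+1)}) := \sum_i (del * ((k i)%:R - K%:R)) *: e i.
exists (map y (enum {ffun 'I_n -> 'I_(K.*2.+1)})) => c cB.
have [c' c'E c'b] := HC c; rewrite -c'E in c'b cB *.
have Kb i : `|Num.floor (c' i / del)| <= K%:Z.
  have h1 : `|c' i / del| < (Num.bound (C * `|B| / del))%:R.
    have q0 : 0 <= C * `|B| / del by apply: divr_ge0; [exact: mulr_ge0|exact: ltW].
    apply: le_lt_trans (archi_boundP q0).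
    rewrite normrM normfV (gtr0_norm del0) ler_pM2r ?invr_gt0//.
    by apply: le_trans (c'b i) _; rewrite ler_wpM2l// (le_trans cB)// ler_norm.
  have /andP[h2 h3] := floor_itv (c' i / del).
  move: h1; rewrite ltr_norml => /andP[h4 h5].
  have h6 := le_lt_trans h2 h5.
  have h7 := lt_trans h4 h3.
  move: h6 h7; rewrite /K; set m := Num.bound _ => h6 h7.
  have {h6} : (Num.floor (c' i / del))%:~R < (m%:Z)%:~R :> R by [].
  have {h7} : (- m%:Z)%:~R < (Num.floor (c' i / del) + 1)%:~R :> R by rewrite intrN.
  rewrite !ltr_int; lia.
(* The floors lie in [-K, K]; adding K encodes them as ordinals below 2K + 1. *)
pose k := [ffun i => inord (absz (Num.floor (c' i / del) + K%:Z)) : 'I_(K.*2.+1)].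
exists (y k); first by apply: map_f; rewrite mem_enum.
rewrite /y -sumrB; apply: le_trans (ler_norm_sum _ _ _) _.
apply: (@le_trans _ _ (\sum_i del * `|e i|)).
  apply: ler_sum => i _; rewrite -scalerBl normrZ ler_wpM2r//.
  have -> : (k i)%:R - K%:R = (Num.floor (c' i / del))%:~R :> R.
    rewrite /k ffunE inordK; last by have := Kb i; lia.
    rewrite [_%:R]pmulrn [K%:R]pmulrn -intrB; congr (_%:~R); have := Kb i; lia.
  have /andP[h2 h3] := floor_itv (c' i / del).
  rewrite ler_pdivlMr// in h2; rewrite ltr_pdivrMr// intrD in h3.
  rewrite mulrC ger0_norm ?subr_ge0// lerBlDr; apply: le_trans (ltW h3) _.
  by rewrite mulrDl mul1r addrC.
rewrite -mulr_sumr /del -mulrA ler_piMr ?(ltW e0)// mulrC ler_pdivrMr// mul1r.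
by rewrite lerDl.
Qed.

End FiniteDim.

(** * Regular functions are step approximable *)

Section LpbNorm.
Context {R : realType} {V : normedModType R}.
Implicit Types f : R -> V.
Variable p : R.
Hypothesis p0 : 0 < p.

Lemma Lp_norm_Lp_int f A (r : R) : 0 <= r -> (Lp_norm p f A <= r%:E)%E ->
  (Lp_int p f A <= (r `^ p)%:E)%E.
Proof.
move=> r0; rewrite /Lp_norm => H.
have I0 := Lp_int_ge0 p f A.
have : ((Lp_int p f A `^ p^-1) `^ p <= r%:E `^ p)%E.
  by apply: gt0_ler_poweR; rewrite ?(ltW p0)// in_itv/= leey andbT ?poweR_ge0 ?lee_fin.
by rewrite -poweRrM mulVf ?gt_eqF// poweRe1// poweR_EFin.
Qed.

Lemma Lp_int_Lp_norm f A (r : R) : 0 <= r -> (Lp_int p f A <= (r `^ p)%:E)%E ->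
  (Lp_norm p f A <= r%:E)%E.
Proof.
move=> r0 H; rewrite /Lp_norm.
have I0 := Lp_int_ge0 p f A.
have : (Lp_int p f A `^ p^-1 <= (r `^ p)%:E `^ p^-1)%E.
  by apply: gt0_ler_poweR; rewrite ?invr_ge0 ?(ltW p0)// in_itv/= leey andbT ?lee_fin ?powR_ge0.
by rewrite poweR_EFin -powRrM mulfV ?gt_eqF// powRr1.
Qed.

Lemma Lpb_norm_Lp_int f (eta : R) : 0 <= eta -> (Lpb_norm p f <= eta%:E)%E ->
  forall a, (Lp_int p f `[a, (a + 1)%R] <= (eta `^ p)%:E)%E.
Proof.
move=> eta0 H a; rewrite Lp_int_itvoo; apply: Lp_norm_Lp_int => //.
by apply: le_trans H; apply: ereal_sup_ubound; exists a.
Qed.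

Lemma Lp_int_Lpb_norm f (eta : R) : 0 <= eta ->
  (forall a, (Lp_int p f `[a, (a + 1)%R] <= (eta `^ p)%:E)%E) ->
  (Lpb_norm p f <= eta%:E)%E.
Proof.
move=> eta0 H; apply: ge_ereal_sup => _ [a _ <-]; apply: Lp_int_Lp_norm => //.
by rewrite -Lp_int_itvoo.
Qed.

End LpbNorm.

(* The grid width and the finite set of values do not depend on the translation s; this is what
   makes the property equivalent to both sides of the theorem. *)
Definition step_approximable {R : realType} {V : normedModType R} (p : R) (g : R -> V) :=
  forall eps : R, 0 < eps -> exists (N : nat) (F : seq V), forall s : R,
    exists2 w : int -> V, (forall j, w j \in F) &
      forall k : int, (Lp_int p (fun t => (g (t + s) - w (cell N t))%R)
                        `[k%:~R, (k%:~R + 1)%R] <= eps%:E)%E.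

Section Regular.
Context {R : realType} {V : normedModType R}.
Local Notation mu := (@lebesgue_measure R).
Variable p : R.
Hypothesis p1 : 1 < p.
Let p0 : 0 < p. Proof. exact: lt_trans p1. Qed.
Let p0' : 0 <= p. Proof. exact: ltW. Qed.

Lemma finite_range_seq (T : Type) (w : T -> V) (F : seq V) :
  (forall j, w j \in F) -> finite_set (range w).
Proof. by move=> wF; apply: (sub_finite_set _ (finite_seq F)) => _ [j _ <-]; exact: wF. Qed.

(** Otherwise |h|^p would exceed its mean by more than eta on the whole interval, and integrating
    the constant mean + eta gives a contradiction. *)
Lemma Lp_int_point_le (h : R -> V) (a d eta : R) : 0 < d -> 0 < eta ->
  exists2 tau, a <= tau <= a + d &
    ((`|h tau| `^ p * d)%:E <= Lp_int p h `[a, (a + d)%R] + (eta * d)%:E)%E.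
Proof.
move=> d0 eta0; apply: contrapT => H.
have ad : a <= a + d by rewrite lerDl ltW.
have gt tau : a <= tau <= a + d ->
    (Lp_int p h `[a, (a + d)%R] + (eta * d)%:E < (`|h tau| `^ p * d)%:E)%E.
  by move=> tauad; rewrite ltNge; apply/negP => Hle; apply: H; exists tau.
have I0 := Lp_int_ge0 p h `[a, a + d].
(* The negated claim at the single point a already rules out an infinite integral. *)
have Ifin : Lp_int p h `[a, a + d] \is a fin_num.
  rewrite ge0_fin_numE//; have /gt : a <= a <= a + d by rewrite lexx.
  case: (Lp_int p h `[a, a + d]) I0 => // r _ _; exact: ltry.
pose q := fine (Lp_int p h `[a, a + d]).
have qE : Lp_int p h `[a, a + d] = q%:E by rewrite fineK.
have : (\int[mu]_(t in `[a, (a + d)%R]) (q / d + eta)%:E <= Lp_int p h `[a, (a + d)%R])%E.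
  have q0 : 0 <= q by rewrite -lee_fin -qE.
  apply: ae_le_lower_integral => [x|x|]; rewrite ?lee_fin ?powR_ge0//.
    by rewrite addr_ge0// ?divr_ge0 ?(ltW d0) ?(ltW eta0).
  apply: aeW => t tad; split => //; rewrite lee_fin ltW//.
  have := gt t; rewrite qE -EFinD lte_fin -ltr_pdivrMr// mulrDl mulfK ?gt_eqF//; apply.
  by move: tad; rewrite /= in_itv.
have -> : (\int[mu]_(t in `[a, (a + d)%R]) (q / d + eta)%:E = (q / d + eta)%:E * mu `[a,
  (a + d)%R])%E.
  exact: integral_cst.
rewrite lebesgue_measure_itv/= lte_fin ltrDl d0 -EFinD addrAC subrr add0r qE -EFinM lee_fin.
by rewrite mulrDl divfK ?gt_eqF// gerDl leNgt mulr_gt0.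
Qed.

(** With tau from [Lp_int_point_le] and y near g2 tau, g1 t - y splits into g1 t - g1 tau, g2 tau -
    y and g1 tau - g2 tau: two errors of size eta and one controlled by the mean. The net is
    required only at points satisfying the mean bound, where g2 is under control. *)
Lemma Lp_int_cell_le (g1 g2 : R -> V) (F : seq V) (M a d eta : R) :
  0 < d -> 0 < eta -> 0 <= M -> M * d <= eta ->
  (forall x y, `|g1 x - g1 y| <= M * `|x - y|) ->
  (forall t, a <= t <= a + d ->
    ((`|g1 t - g2 t| `^ p * d)%:E <= Lp_int p (fun t => (g1 t - g2 t)%R) `[a,
      (a + d)%R] + (eta * d)%:E)%E ->
     exists2 y, y \in F & `|g2 t - y| <= eta) ->
  exists2 y, y \in F &
    (Lp_int p (fun t => (g1 t - y)%R) `[a, (a + d)%R] <= (2 `^ p)%:E *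
      Lp_int p (fun t => (g1 t - g2 t)%R) `[a,
        (a + d)%R] + (2 `^ p * ((2 * eta) `^ p + eta) * d)%:E)%E.
Proof.
move=> d0 eta0 M0 Md lip net.
have [tau tauad le_tau] := Lp_int_point_le (fun t => g1 t - g2 t) a d0 eta0.
have [y yF g2y] := net _ tauad le_tau; exists y => //.
pose r := `|g1 tau - g2 tau|.
apply: (@le_trans _ _ ((2 * eta + r) `^ p * (a + d - a))%:E).
  apply: Lp_int_le_cst => //; first by rewrite lerDl ltW.
  move=> t tad; have -> : g1 t - y = (g1 t - g1 tau) + (g2 tau - y) + (g1 tau - g2 tau).
    by rewrite [RHS]addrAC !subrKA.
  apply: le_trans (ler_normD _ _) _; rewrite lerD2r.
  apply: le_trans (ler_normD _ _) _; rewrite mulr_natl mulr2n lerD//.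
  apply: le_trans (lip _ _) _; apply: le_trans Md; rewrite ler_wpM2l// ler_norml.
  by move: tad tauad => /andP[? ?] /andP[? ?]; apply/andP; split; lra.
have -> : a + d - a = d by ring.
apply: (@le_trans _ _ (2 `^ p * ((2 * eta) `^ p + r `^ p) * d)%:E).
  have eta2 : 0 <= 2 * eta by rewrite mulr_ge0// ltW.
  have r0 : 0 <= r by exact: normr_ge0.
  by rewrite lee_fin ler_wpM2r ?(ltW d0)// powR_addr_le.
have -> : (2 `^ p * ((2 * eta) `^ p + r `^ p) * d = 2 `^ p * (r `^ p * d) + 2 `^ p * (2 * eta)
  `^ p * d)%R.
  ring.
have -> : (2 `^ p * ((2 * eta) `^ p + eta) * d = 2 `^ p * (eta * d) + 2 `^ p * (2 * eta) `^ p
  * d)%R.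
  ring.
rewrite EFinD [in leRHS]EFinD addeA; apply: leeD => //.
rewrite EFinM [(2 `^ p * (eta * d))%:E]EFinM.
have e0 : (0 <= (eta * d)%:E)%E by rewrite lee_fin mulr_ge0 ?(ltW eta0) ?(ltW d0).
rewrite -(ge0_muleDr _ (Lp_int_ge0 _ _ _) e0).
by apply: lee_wpmul2l => //; rewrite lee_fin powR_ge0.
Qed.

Lemma regular_step_approximable (g : R -> V) : Lp_b p g ->
  space_regular p g -> time_regular p g -> step_approximable p g.
Proof.
move=> [[mg _] _] SR TR eps eps0.
pose A := 2 `^ p : R.
have A0 : 0 < A by apply: powR_gt0.
(* C eta is the final bound: the 1 comes from g - g1, the rest from g1 minus the step function. *)
pose C := A * (1 + (A * (A * 2) + A * (A + 1))).
have C0 : 0 < C by rewrite mulr_gt0// ltr_pwDl// addr_ge0// ltW// ?mulr_gt0 ?addr_gt0.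
(* The bound by 1 gives eta^p <= eta, which makes all errors linear in eta. *)
pose eta := Num.min 1 (eps / C).
have eta0 : 0 < eta by rewrite lt_min ltr01 divr_gt0.
have etap : eta `^ p <= eta by rewrite ge1r_powR ?eta0 ?ge_min ?lexx// ltW.
have [n [e [g2 [g2e [[[mg2 _] _] gg2]]]]] := SR _ eta0.
have [g1 [g1C gg1]] := TR _ eta0.
have [dg1 [cg1 [M1 HM1]]] := g1C 1%N.
have [dg0 [cg0 [M0 HM0]]] := g1C 0%N.
have mg1 : strongly_measurable g1.
  exact: continuous_strongly_measurable cg0.
pose M := `|M1|.
have lip x y : `|g1 x - g1 y| <= M * `|x - y|.
  wlog xy : x y / x <= y.
    by move=> H; have [xy|yx] := leP x y; [exact: H|rewrite distrC [`|x - y|]distrC; apply: H;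
      exact: ltW].
  rewrite distrC [`|x - y|]distrC [`|y - x|]ger0_norm ?subr_ge0//.
  by apply: mean_value_le => // z; apply: le_trans (HM1 z) (ler_norm _).
pose h t := g1 t - g2 t.
have mh : strongly_measurable h by exact: strongly_measurableB.
have hI a : (Lp_int p h `[a, (a + 1)%R] <= (A * (2 * eta))%:E)%E.
  apply: (@le_trans _ _ (A%:E * (Lp_int p (fun t => (g t - g2 t)%R) `[a, (a + 1)%R] +
      Lp_int p (fun t => (g t - g1 t)%R) `[a, (a + 1)%R]))%E).
    apply: Lp_int_triangle => //; [exact: strongly_measurableB..|move=> t _].
    have -> : h t = (g t - g2 t) - (g t - g1 t) by rewrite opprB addrC subrKA.
    exact: ler_normB.
  rewrite EFinM; apply: lee_wpmul2l; first by rewrite lee_fin ltW.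
  rewrite mulr_natl mulr2n EFinD; apply: leeD.
    by apply: le_trans (Lpb_norm_Lp_int p0 (ltW eta0) gg2 a) _; rewrite lee_fin.
  by apply: le_trans (Lpb_norm_Lp_int p0 (ltW eta0) gg1 a) _; rewrite lee_fin.
(* Cells so short that the Lipschitz function g1 varies by at most eta on each. *)
pose N := Num.bound (M / eta).
pose d := (N.+1%:R : R)^-1.
have d0 : 0 < d by rewrite invr_gt0 ltr0n.
have Md : M * d <= eta.
  rewrite ler_pdivrMr ?ltr0n// mulrC -ler_pdivrMr//.
  have := archi_boundP (divr_ge0 (normr_ge0 M1) (ltW eta0)).
  by move=> /ltW/le_trans; apply; rewrite ler_nat.
(* Bound for |h|^p at the selected points: the integral over a unit window plus the slack, divided
   by the cell length. As p > 1 it yields |h| <= 1 + Q, so g2 = g1 - h is at most M0 + 1 + Q there.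
   Neither Q nor the net depends on the translation. *)
pose Q := (A * (2 * eta) + eta * d) / d.
have [F HF] := span_bounded_net e (M0 + (1 + Q)) eta0.
exists N, F => s.
have cellE (j : int) : exists2 y, y \in F &
    (Lp_int p (fun t => (g1 (t + s) - y)%R) `[(j%:~R * d)%R, (j%:~R * d + d)%R] <=
     A%:E * Lp_int p (fun t => h (t + s)%R) `[(j%:~R * d)%R, (j%:~R * d + d)%R] +
     (A * ((2 * eta) `^ p + eta) * d)%:E)%E.
  apply: (@Lp_int_cell_le (fun t => g1 (t + s)) (fun t => g2 (t + s)) F M) => //.
  - exact: normr_ge0.
  - by move=> x y; apply: le_trans (lip _ _) _; rewrite opprD addrACA subrr addr0.
  move=> t _ tle; have [c cE] := g2e (t + s); rewrite cE; apply: HF; rewrite -cE.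
  have -> : g2 (t + s) = g1 (t + s) - h (t + s) by rewrite /h subKr.
  apply: le_trans (ler_normB _ _) _; apply: lerD; first exact: HM0.
  have hQ : `|h (t + s)| `^ p <= Q.
    rewrite ler_pdivlMr// -lee_fin; apply: le_trans tle _.
    rewrite EFinD leeD2r//; apply: le_trans (hI (j%:~R * d + s)).
    rewrite (Lp_int_shift p _ _ _ mh); apply: Lp_int_subset.
    apply: subset_itvl; rewrite bnd_simp -addrA [d + s]addrC addrA lerD2l.
    by rewrite invf_le1 ?ltr0n// ler1n.
  have [h1|h1] := leP `|h (t + s)| 1.
    by apply: le_trans h1 _; rewrite lerDl; apply: le_trans hQ; rewrite powR_ge0.
  apply: le_trans (le1r_powR (ltW h1) (ltW p1)) _; apply: le_trans hQ _.
  by rewrite lerDr.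
have [w wP] := choice (fun j => let: ex_intro2 y h1 h2 := cellE j in ex_intro _ y (conj h1 h2)).
have wF j : w j \in F by have [] := wP j.
exists w => // k.
have mw : strongly_measurable (fun t : R => w (cell N t)).
  exact: simple_fun_strongly_measurable (simple_fun_cell _ (finite_range_seq wF)).
have Nd : N.+1%:R * d = 1 by rewrite mulfV// gt_eqF// ltr0n.
have step1 : (Lp_int p (fun t => (g1 (t + s) - w (cell N t))%R) `[k%:~R, (k%:~R + 1)%R] <=
    (A * (A * (2 * eta)) + A * ((2 * eta) `^ p + eta))%:E)%E.
  have := @Lp_int_uniform_split _ _ p (fun t => g1 (t + s) - w (cell N t)) (fun t => h (t + s))
    k%:~R d A (A * ((2 * eta) `^ p + eta) * d) N.+1 (ltW d0) (ltW A0).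
  rewrite /= Nd => /(_ (strongly_measurableB (strongly_measurable_shift s mg1) mw)).
  move=> /(_ (strongly_measurable_shift s mh)) H.
  apply: le_trans (H _) _ => {H}.
    (* The i-th cell of the window [k, k+1] has index k(N+1) + i. Passing to the open interval drops
       its right endpoint, which belongs to the next cell. *)
    move=> i iN; pose j := k * N.+1%:Z + i%:Z.
    have jd : k%:~R + i%:R * d = j%:~R * d :> R.
      by rewrite /j intrD intrM mulrDl -mulrA; congr (_ + _); rewrite [X in _ * X]Nd mulr1.
    have jd1 : k%:~R + i.+1%:R * d = j%:~R * d + d :> R.
      by rewrite -jd -natr1 mulrDl mul1r addrA.
    rewrite jd jd1; apply: le_trans (wP j).2; rewrite Lp_int_itvoo [leRHS]Lp_int_itvoo.
    apply: ae_le_Lp_int; apply: aeW => t tI; split => //.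
    have -> // : cell N t = j.
    apply/eqP; rewrite cellP; move: tI; rewrite /= in_itv/= => /andP[t1 t2].
    by rewrite ltW//= intrD mulrDl mul1r.
  rewrite [in leRHS]EFinD; apply: leeD.
    rewrite EFinM; apply: lee_wpmul2l; first by rewrite lee_fin ltW.
    by rewrite (Lp_int_shift p _ _ _ mh) addrAC.
  by rewrite lee_fin mulrCA Nd mulr1.
have step2 : (Lp_int p (fun t => (g (t + s) - g1 (t + s))%R) `[k%:~R, (k%:~R + 1)%R] <= eta%:E)%E.
  rewrite (@Lp_int_shift _ _ p (fun t => g t - g1 t)); last exact: strongly_measurableB.
  rewrite addrAC; apply: le_trans (Lpb_norm_Lp_int p0 (ltW eta0) gg1 _) _; by rewrite lee_fin.
apply: (@le_trans _ _ (A%:E * (eta%:E + (A * (A * (2 * eta)) + A * ((2 * eta) `^ p +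
  eta))%:E))%E).
  apply: le_trans (lee_wpmul2l _ (leeD step2 step1)); last by rewrite lee_fin ltW.
  apply: Lp_int_triangle => //.
  - by apply: strongly_measurableB; exact: strongly_measurable_shift.
  - by apply: strongly_measurableB => //; exact: strongly_measurable_shift.
  - by move=> t _; apply: le_trans (ler_normD _ _); rewrite subrKA.
rewrite -EFinD -EFinM lee_fin.
apply: (@le_trans _ _ (C * eta)); last first.
  by rewrite mulrC -ler_pdivlMr// ge_min lexx orbT.
rewrite /C -!mulrA ler_wpM2l ?(ltW A0)//.
have -> : (1 + (A * (A * 2) + A * (A + 1))) * eta = eta + (A * (A * (2 * eta)) + A * (A * eta
  + eta)) by ring.
rewrite lerD2l lerD2l ler_wpM2l ?(ltW A0)// lerD2r powRM ?(ltW eta0)// ler_wpM2l ?(ltW A0)//.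
Qed.

End Regular.

(** * Step-approximable functions are regular *)

Section StepRegular.
Context {R : realType} {V : normedModType R}.
Variable p : R.
Hypothesis p1 : 1 < p.
Let p0 : 0 < p. Proof. exact: lt_trans p1. Qed.
Let p0' : 0 <= p. Proof. exact: ltW. Qed.

Lemma seq_norm_bound (F : seq V) : exists2 B : R, 0 <= B & forall y, y \in F -> `|y| <= B.
Proof.
elim: F => [|x F [B B0 HB]]; first by exists 0.
exists (`|x| + B); first by rewrite addr_ge0.
move=> y; rewrite inE => /predU1P[->|/HB yB]; first by rewrite lerDl.
by apply: le_trans yB _; rewrite lerDr.
Qed.

(** A unit window is covered by two consecutive integer windows, hence the factor 2; for this reason
    [step_approximable] may speak of integer windows only. *)
Lemma Lp_int_window (f : R -> V) (c : R) : strongly_measurable f ->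
  (forall k : int, (Lp_int p f `[k%:~R, (k%:~R + 1)%R] <= c%:E)%E) ->
  forall a, (Lp_int p f `[a, (a + 1)%R] <= (2 * c)%:E)%E.
Proof.
move=> mf H a; have /andP[h1 h2] := floor_itv a.
set k := Num.floor a in h1 h2.
apply: (@le_trans _ _ (Lp_int p f `[k%:~R, (k + 1)%:~R + 1])).
  by apply: Lp_int_subset; apply: subset_itv; rewrite bnd_simp// lerD2r ltW.
rewrite (@Lp_int_itv_split _ _ _ _ k%:~R (k + 1)%:~R)//; last 2 first.
- by rewrite ler_int lerDl.
- by rewrite lerDl.
rewrite mulr_natl mulr2n EFinD; apply: leeD => //.
by rewrite intrD; exact: H.
Qed.

Lemma step_space_regular (g : R -> V) : strongly_measurable g ->
  step_approximable p g -> space_regular p g.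
Proof.
move=> mg SA eps eps0.
have e0 : 0 < eps `^ p / 2 by rewrite divr_gt0// powR_gt0.
have [N [F /(_ 0)[w wF wI]]] := SA _ e0.
have [B B0 HB] := seq_norm_bound F.
have mw : strongly_measurable (fun t : R => w (cell N t)).
  exact: simple_fun_strongly_measurable (simple_fun_cell _ (finite_range_seq wF)).
(* The values in F span the subspace; the coefficients are the unit vector at the index of the
   value. *)
exists (size F), (fun i => F`_i), (fun t => w (cell N t)); split.
  move=> t; have iF : (index (w (cell N t)) F < size F)%N by rewrite index_mem.
  exists (fun i => (i == Ordinal iF)%:R).
  rewrite (bigD1 (Ordinal iF))//= eqxx scale1r nth_index// big1 ?addr0// => i /negbTE->.
  by rewrite scale0r.
have bnd a b : a <= b -> (Lp_int p (fun t => w (cell N t)) `[a, b] <= (B `^ p * (b - a))%:E)%E.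
  by move=> ab; apply: Lp_int_le_cst => // t _; exact: HB.
split.
  split; first split => //.
    move=> a b; have [ab|ba] := leP a b; first exact: le_lt_trans (bnd _ _ ab) (ltry _).
    by rewrite set_itv_ge ?bnd_simp -?ltNge// /Lp_int integral_set0 ltry.
  apply: (@le_lt_trans _ _ B%:E); last exact: ltry.
  apply: (Lp_int_Lpb_norm p0) => // a; apply: le_trans (bnd _ _ _) _; first by rewrite lerDl.
  by rewrite addrAC subrr add0r mulr1.
apply: (Lp_int_Lpb_norm p0) => [|a]; first exact: ltW.
have -> : eps `^ p = 2 * (eps `^ p / 2) by rewrite mulrC divfK.
apply: Lp_int_window; first exact: strongly_measurableB.
by move=> k; under eq_fun do rewrite -[X in g X]addr0; exact: wI.
Qed.

Lemma step_time_regular (g : R -> V) : strongly_measurable g ->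
  step_approximable p g -> time_regular p g.
Proof.
move=> mg SA eps eps0.
pose A := 2 `^ p : R.
have A0 : 0 < A by apply: powR_gt0.
(* The 4 splits as 2 for the passage to arbitrary windows and 2 for the two errors; A is the
   triangle constant. *)
pose del := eps `^ p / (4 * A).
have del0 : 0 < del by rewrite divr_gt0 ?powR_gt0 ?mulr_gt0.
have [N [F /(_ 0)[w wF wI]]] := SA _ del0.
have [B B0 HB] := seq_norm_bound F.
have mw : strongly_measurable (fun t : R => w (cell N t)).
  exact: simple_fun_strongly_measurable (simple_fun_cell _ (finite_range_seq wF)).
pose d := (N.+1%:R : R)^-1.
have d0 : 0 < d by rewrite invr_gt0 ltr0n.
have Nd : N.+1%:R * d = 1 by rewrite mulfV// gt_eqF// ltr0n.
pose Q := (2 * B) `^ p + 1.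
have Q0 : 0 < Q by rewrite ltr_wpDl// powR_ge0.
(* The first bound keeps a transition inside its cell. The second makes its cost (2B)^p eta at most
   del d, which adds up to del over the N+1 cells of a unit window. *)
pose eta := Num.min (d / 2) (del * d / Q).
have eta0 : 0 < eta.
  rewrite lt_min; apply/andP; split; first exact: divr_gt0.
  by apply: divr_gt0 => //; exact: mulr_gt0.
have etad : eta < d by rewrite gt_min ltr_pdivrMr// mulr_natr mulr2n ltrDr d0.
have [G [GC G2 Geq]] := smoothed_step (fun j => HB _ (wF j)) eta0 etad.
exists G; split => //.
have [_ [cG _]] := GC 0%N.
have mG : strongly_measurable G.
  exact: continuous_strongly_measurable cG.
apply: (Lp_int_Lpb_norm p0) => [|a]; first exact: ltW.
have -> : eps `^ p = 2 * (A * (del + del)).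
  by rewrite /del; field; rewrite gt_eqF.
apply: Lp_int_window; first exact: strongly_measurableB.
move=> k.
have mGw : strongly_measurable (fun t => G t - w (cell N t)) by exact: strongly_measurableB.
have step1 : (Lp_int p (fun t => (g t - w (cell N t))%R) `[k%:~R, (k%:~R + 1)%R] <= del%:E)%E.
  by under eq_fun do rewrite -[X in g X]addr0; exact: wI.
have step2 : (Lp_int p (fun t => (G t - w (cell N t))%R) `[k%:~R, (k%:~R + 1)%R] <= del%:E)%E.
  have := @Lp_int_uniform_split _ _ p (fun t => G t - w (cell N t)) g k%:~R d 0 (del * d) N.+1
    (ltW d0) (lexx 0) mGw mg.
  rewrite /= Nd mulrCA Nd mulr1 mul0e add0e; apply.
  move=> i iN; rewrite mul0e add0e; pose j := k * N.+1%:Z + i%:Z.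
  have jd : k%:~R + i%:R * d = j%:~R * d :> R.
    by rewrite /j intrD intrM mulrDl -mulrA; congr (_ + _); rewrite [X in _ * X]Nd mulr1.
  have jd1 : k%:~R + i.+1%:R * d = j%:~R * d + d :> R.
    by rewrite -jd -natr1 mulrDl mul1r addrA.
  rewrite jd jd1 (@Lp_int_itv_split _ _ _ _ _ (j%:~R * d + eta))//; last 2 first.
  - by rewrite lerDl ltW.
  - by rewrite lerD2l ltW.
  rewrite -[leRHS]adde0; apply: leeD.
    apply: le_trans (Lp_int_le_cst (M := 2 * B) p0 _ _) _ => //; first by rewrite lerDl ltW.
    rewrite addrAC subrr add0r lee_fin; apply: (@le_trans _ _ (Q * eta)).
      by rewrite ler_wpM2r ?(ltW eta0)// lerDl.
    by rewrite mulrC -ler_pdivlMr// ge_min lexx orbT.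
  apply: le_trans (Lp_int_le_cst (M := 0) p0 _ _) _.
  - by rewrite lerD2l ltW.
  - move=> t /andP[t1 t2]; rewrite normr_le0 subr_eq0; apply/eqP; apply: Geq.
    have -> : cell N t = j.
      apply/eqP; rewrite cellP intrD mulrDl mul1r t2 andbT ltW//.
      by apply: le_lt_trans t1; rewrite lerDl ltW.
    by rewrite ltrBrDl.
  - by rewrite powR0 ?gt_eqF// mul0r.
rewrite EFinM [in leRHS]EFinD.
apply: le_trans (lee_wpmul2l _ (leeD step1 step2)); last by rewrite lee_fin ltW.
apply: Lp_int_triangle => //; first exact: strongly_measurableB.
move=> t _; rewrite [`|G t - _|]distrC; apply: le_trans (ler_normD _ _).
by rewrite subrKA.
Qed.

End StepRegular.

(** * Translation-compact functions are step approximable *)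

Section Density.
Context {R : realType} {V : normedModType R}.
Local Notation mu := (@lebesgue_measure R).
Variable p : R.
Hypothesis p1 : 1 < p.
Let p0 : 0 < p. Proof. exact: lt_trans p1. Qed.
Let p0' : 0 <= p. Proof. exact: ltW. Qed.

Definition continuous_approximable (f : R -> V) := forall eps : R, 0 < eps ->
  exists2 c : R -> V, continuous c &
    (Lp_int p (fun t => (f t - c t)%R) `[0%R, 1%R] <= eps%:E)%E.

Lemma continuous_approximableD (f g : R -> V) :
  strongly_measurable f -> strongly_measurable g ->
  continuous_approximable f -> continuous_approximable g ->
  continuous_approximable (fun t => f t + g t).
Proof.
move=> mf mg Cf Cg eps eps0.
pose A := 2 `^ p : R.
have A0 : 0 < A by apply: powR_gt0.
have e0 : 0 < eps / (A * 2) by apply: divr_gt0 => //; apply: mulr_gt0.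
have [c cc cE] := Cf _ e0; have [d cd dE] := Cg _ e0.
exists (fun t => c t + d t) => [t|]; first by apply: cvgD; [exact: cc|exact: cd].
have -> : eps = A * (eps / (A * 2) + eps / (A * 2)) by field; rewrite gt_eqF.
rewrite EFinM EFinD; apply: le_trans (lee_wpmul2l _ (leeD cE dE)); last by rewrite lee_fin ltW.
apply: Lp_int_triangle => //.
- by apply: strongly_measurableB => //; exact: continuous_strongly_measurable.
- by apply: strongly_measurableB => //; exact: continuous_strongly_measurable.
- by move=> t _; rewrite opprD addrACA; exact: ler_normD.
Qed.

Lemma cvge_le_near (u : nat -> \bar R) (e : R) : u @ \oo --> 0%E -> 0 < e ->
  \forall n \near \oo, (u n <= e%:E)%E.
Proof.
move=> u0 e0; have /fine_cvgP[ufin /cvgrPdist_le /(_ _ e0) ue] := u0.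
near=> n; rewrite -[u n]fineK; last by near: n.
rewrite lee_fin; apply: le_trans (ler_norm _) _; rewrite -normrN -[X in `|X|]add0r.
by near: n.
Unshelve. all: by end_near. Qed.

(** The formula (1 + |y| - |y - 1|)/2 is the truncation of y to [0,1], written so that its
    continuity is evident. *)
Lemma clamp_le (b y : R) : b = 0 \/ b = 1 ->
  `|b - (1 + `|y| - `|y - 1|) / 2| <= `|b - y| /\ `|b - (1 + `|y| - `|y - 1|) / 2| <= 1.
Proof.
have h1 := ler_norm (b - y); have h2 := ler_norm (- (b - y)); rewrite normrN in h2.
rewrite !ler_norml; move: `|b - y| h1 h2 => z h1 h2.
have [[h3 e3]|[h3 e3]] : (0 <= y /\ `|y| = y) \/ (y <= 0 /\ `|y| = - y).
- by have [y0|y0] := leP 0 y; [left; rewrite ger0_norm|right; rewrite ltr0_norm// ltW].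
- have [[h4 e4]|[h4 e4]] : (1 <= y /\ `|y - 1| = y - 1) \/ (y <= 1 /\ `|y - 1| = 1 - y).
    have [y0|y0] := leP 1 y; [left; rewrite ger0_norm ?subr_ge0//|right].
    by rewrite distrC gtr0_norm ?subr_gt0// ltW.
  + by rewrite e3 e4; case=> bE; rewrite bE in h1 h2 *; split; apply/andP; split; lra.
  + by rewrite e3 e4; case=> bE; rewrite bE in h1 h2 *; split; apply/andP; split; lra.
- have e4 : `|y - 1| = 1 - y by rewrite distrC ger0_norm// subr_ge0; lra.
  by rewrite e3 e4; case=> bE; rewrite bE in h1 h2 *; split; apply/andP; split; lra.
Qed.

(** Continuous functions are dense in L^1. Once truncated to [0,1] they differ from the indicator by
    at most 1, so the p-th power of the error is below the error and L^1 closeness yields L^p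
    closeness. *)
Lemma indic_approximable (B : set R) (x : V) : measurable B ->
  continuous_approximable (fun t => (\1_B t : R) *: x).
Proof.
move=> mB eps eps0.
have iB : mu.-integrable `[0%R, 1%R] (EFin \o (\1_B : R -> R)).
  apply: measurable_bounded_integrable => //.
  - exact: (compact_finite_measure (@segment_compact _ 0 1)).
  - exists 1; split => // M M1 t _ /=; rewrite indicE; apply: le_trans (ltW M1).
    by case: (t \in B); rewrite ?normr1 ?normr0.
have [g [cg ig gB]] := approximation_continuous_integrable (measurable_itv `[0%R, 1%R])
  (compact_finite_measure (@segment_compact _ 0 1)) iB.
pose Q := `|x| `^ p + 1.
have Q0 : 0 < Q by rewrite ltr_wpDl// powR_ge0.
have [n gn] : exists n, (\int[mu]_(z in `[0%R, 1%R]) `|((\1_B z :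
  R) - g n z)%:E| <= (eps / Q)%:E)%E.
  have e0 : 0 < eps / Q by exact: divr_gt0.
  have : \forall n \near \oo, (\int[mu]_(z in `[0%R, 1%R]) `|((\1_B z :
    R) - g n z)%:E| <= (eps / Q)%:E)%E.
    exact: (cvge_le_near gB e0).
  by case=> m _ Hm; exists m; apply: Hm => /=.
pose c t := (1 + `|g n t| - `|g n t - 1|) / 2.
have cc : continuous c.
  move=> t; apply: cvgM; last exact: cvg_cst.
  apply: cvgB; first by apply: cvgD; [exact: cvg_cst|apply: cvg_norm; exact: cg].
  by apply: cvg_norm; apply: cvgB; [exact: cg|exact: cvg_cst].
exists (fun t => c t *: x); first by move=> t; apply: cvgZr_tmp; exact: cc.
apply: (@le_trans _ _ (\int[mu]_(z in `[0%R, 1%R]) (Q%:E * `|((\1_B z : R) - g n z)%:E|))%E).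
  apply: ae_le_lower_integral => [t|t|].
  - by rewrite lee_fin powR_ge0.
  - by rewrite mule_ge0// lee_fin ltW.
  apply: aeW => t tI; split=> //.
  rewrite abse_EFin -EFinM lee_fin -scalerBl normrZ powRM// mulrC ler_pM ?powR_ge0//;
    first by rewrite lerDl.
  have ci : `|\1_B t - c t| <= `|\1_B t - g n t| /\ `|\1_B t - c t| <= 1.
    by apply: clamp_le; rewrite indicE; case: (t \in B); [right|left].
  have [->|nz] := eqVneq `|\1_B t - c t| 0; first by rewrite powR0 ?gt_eqF.
  apply: le_trans ci.1; apply: ge1r_powR; last exact: ltW.
  by rewrite ci.2 andbT lt_neqAle eq_sym nz normr_ge0.
rewrite ge0_integralZl//; last 2 first.
- apply: measurableT_comp => //; apply/measurable_EFinP.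
  apply: measurable_funB; apply: measurable_funTS => //.
  exact: continuous_measurable_fun.
- by rewrite lee_fin ltW.
apply: le_trans (lee_wpmul2l _ gn) _; first by rewrite lee_fin ltW.
by rewrite -EFinM lee_fin mulrC divfK// gt_eqF.
Qed.

Lemma simple_approximable (v : R -> V) : simple_fun v -> continuous_approximable v.
Proof.
move=> sv.
(* Induction on the list of values that are kept; the condition [x \notin S] below prevents a
   repeated value from being added twice. *)
suff H (S : seq V) : continuous_approximable (fun t => if v t \in S then v t else 0).
  have /finite_seqP[S vS] := sv.1.
  have := H S; congr continuous_approximable; apply/funext => t.
  rewrite ifT//; have : range v (v t) by exists t.
  by rewrite vS.
elim: S => [|x S IH].
  move=> eps eps0; exists (cst 0) => [t|]; first exact: cst_continuous.
  apply: le_trans (Lp_int_le_cst (M := 0) p0 ler01 _) _ => [t _|]; first by rewrite subrr normr0.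
  by rewrite powR0 ?gt_eqF// mul0r lee_fin ltW.
have -> : (fun t => if v t \in x :: S then v t else 0) = (fun t =>
   (if v t \in S then v t else 0) + (\1_[set t | v t = x /\ x \notin S] t : R) *: x).
  apply/funext => t; rewrite inE indicE.
  have [vx|/eqP vx] := eqVneq (v t) x.
    rewrite vx; case: (boolP (x \in S)) => xS /=.
      by rewrite memNset ?scale0r ?addr0// => -[].
    by rewrite mem_set//= scale1r add0r.
  by rewrite memNset ?scale0r ?addr0//= => -[].
apply: continuous_approximableD => //.
- apply: simple_fun_strongly_measurable.
  exact: (simple_fun2 (fun y _ => if y \in S then y else 0) sv sv).
- apply: simple_fun_strongly_measurable.
  rewrite (_ : (fun t => _) = (fun t => if (v t == x) && (x \notin S) then x else 0)).
    exact: (simple_fun2 (fun y _ => if (y == x) && (x \notin S) then x else 0) sv sv).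
  apply/funext => t; rewrite indicE; case: ifPn => [/andP[/eqP vx xS]|H].
    by rewrite mem_set// scale1r.
  by rewrite memNset ?scale0r// => -[vx xS]; move: H; rewrite vx eqxx xS.
- apply: indic_approximable.
  exact: (simple_preimage [set y | y = x /\ x \notin S] sv).
Qed.

Lemma Lp_approximable (f : R -> V) : strongly_measurable f ->
  (Lp_int p f `[0%R, 1%R] < +oo)%E -> continuous_approximable f.
Proof.
move=> /strongly_measurable_version[f0 sf ff] If eps eps0.
have [u [su uf]] := sf.
(* The cut gives the domination |f0 - v n| <= 3 |f0| and preserves convergence: it is eventually
   inactive where f0 is nonzero, and v n vanishes where f0 does. Dominated convergence then reduces
   the claim to simple functions. *)
pose v n t := if `|u n t| <= 2 * `|f0 t| then u n t else 0.
have sv n : simple_fun (v n).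
  split.
    apply: (@sub_finite_set _ _ (0 |` range (u n))).
      by move=> _ [t _ <-]; rewrite /v; case: ifP => _; [right|left].
    by rewrite finite_setU; split => //; exact: (su n).1.
  move=> y; have mle : measurable [set t | `|u n t| <= 2 * `|f0 t|].
    have m2 : measurable_fun setT (fun t : R => 2 * `|f0 t|).
      by apply: measurable_funM => //; exact: simple_limit_measurable.
    have := measurable_fun_ler (simple_limit_measurable (simple_fun_limit (su n))) m2.
    by move=> /(_ measurableT [set true] I); rewrite setTI.
  rewrite (_ : v n @^-1` [set y] = ([set t | `|u n t| <= 2 * `|f0 t|] `&` u n @^-1` [set y]) `|`
     (~` [set t | `|u n t| <= 2 * `|f0 t|] `&` [set _ | y = 0])).
    apply: measurableU; apply: measurableI => //.
    - exact: (su n).2.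
    - exact: measurableC.
    - by have [->|/eqP y0] := eqVneq y 0; [rewrite (_ : mkset _ = setT)//; apply/seteqP; split
         |rewrite (_ : mkset _ = set0)//; apply/seteqP; split].
  apply/seteqP; split => t /=; rewrite /v.
    by case: ifPn => [h ->|/negP h <-]; [left|right].
  by case => -[h]; [rewrite h|move: h => /negP/negbTE -> ->].
have vcvg t : v ^~ t @ \oo --> f0 t.
  have [f0t|f0t] := eqVneq (f0 t) 0.
    rewrite (_ : v ^~ t = fun=> 0); first by rewrite f0t; exact: cvg_cst.
    apply/funext => n; rewrite /v f0t normr0 mulr0 normr_le0.
    by case: eqP.
  have : `|f0 t| < 2 * `|f0 t| by rewrite ltr_pMl ?normr_gt0// ltr1n.
  move=> f2.
  apply: cvg_trans (uf t); apply: near_eq_cvg; near=> n; rewrite /v ifT//.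
  by near: n; exact: cvgr_norm_le (uf t) _ f2.
have If0 : (Lp_int p f0 `[0%R, 1%R] < +oo)%E by rewrite -(ae_eq_Lp_int p _ ff).
have sl n : simple_limit (v n) by exact: simple_fun_limit.
have mvf n := simple_limit_powR_measurable p (simple_limitB sf (sl n)).
have mf0 := simple_limit_powR_measurable p sf.
have cvg0 t : (fun n => (`|f0 t - v n t| `^ p)%:E) @ \oo --> 0%E.
  apply/fine_cvgP; split; first exact: nearW.
  apply/cvgrPdist_le => e e0.
  have /cvgrPdist_le := vcvg t.
  move=> /(_ (Num.min e 1)); rewrite lt_min e0 ltr01 => /(_ isT) vn.
  near=> n; rewrite /= sub0r normrN ger0_norm ?powR_ge0//.
  have : `|f0 t - v n t| <= Num.min e 1 by near: n.
  rewrite le_min => /andP[he h1].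
  have [->|nz] := eqVneq `|f0 t - v n t| 0; first by rewrite powR0 ?gt_eqF// ltW.
  by apply: le_trans he; rewrite ge1r_powR ?(ltW p1)// h1 andbT lt_neqAle eq_sym nz normr_ge0.
have dom n t : (`|(`|f0 t - v n t| `^ p)%:E| <= (3 `^ p)%:E * (`|f0 t| `^ p)%:E)%E.
  rewrite abse_EFin ger0_norm ?powR_ge0// -EFinM lee_fin -powRM//.
  apply: ge0_ler_powR; rewrite ?nnegrE ?mulr_ge0//; apply: le_trans (ler_normB _ _) _.
  have : `|v n t| <= 2 * `|f0 t| by rewrite /v; case: ifP => // _; rewrite normr0 mulr_ge0.
  by move=> H; apply: le_trans (lerD (lexx _) H) _; lra.
have ig : mu.-integrable `[0%R, 1%R] (fun t => (3 `^ p)%:E * (`|f0 t| `^ p)%:E)%E.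
  apply/integrableP; split; first by apply: measurable_funTS; exact: measurable_funeM.
  under eq_integral do rewrite -EFinM abse_EFin ger0_norm ?mulr_ge0 ?powR_ge0// EFinM.
  rewrite ge0_integralZl ?lee_fin ?powR_ge0//; first by rewrite lte_mul_pinfty ?lee_fin ?powR_ge0.
  exact: measurable_funTS.
have f_f : {ae mu, forall t, `[0%R,
  1%R]%classic t -> (fun n => (`|f0 t - v n t| `^ p)%:E) @ \oo --> cst 0%E t}.
  by apply: aeW => t _; exact: cvg0.
have f_g : {ae mu, forall t n, `[0%R, 1%R]%classic t ->
    (`|(`|f0 t - v n t| `^ p)%:E| <= (3 `^ p)%:E * (`|f0 t| `^ p)%:E)%E}.
  by apply: aeW => t n _; exact: dom.
have [_ _] := @dominated_convergence _ _ _ mu _ (measurable_itv `[0, 1]) _ (cst 0%E) _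
  (fun n => measurable_funTS (mvf n)) (measurable_cst _) f_f ig f_g.
rewrite integral0 => H.
pose A := 2 `^ p : R.
have A0 : 0 < A by apply: powR_gt0.
have e0 : 0 < eps / (A * 2) by apply: divr_gt0 => //; apply: mulr_gt0.
have [n Hn] : exists n, (Lp_int p (fun t => (f0 t - v n t)%R) `[0%R,
  1%R] <= (eps / (A * 2))%:E)%E.
  by have [n _ Hn] := cvge_le_near H e0; exists n; exact: (Hn n (leqnn n)).
have [c cc cE] := simple_approximable (sv n) e0.
exists c => //.
rewrite (@ae_eq_Lp_int _ _ p (fun t => f t - c t) (fun t => f0 t - c t)); last first.
  by apply: ae_imp ff => t ->.
have -> : eps = A * (eps / (A * 2) + eps / (A * 2)) by field; rewrite gt_eqF.
rewrite EFinM EFinD; apply: le_trans (lee_wpmul2l _ (leeD Hn cE)); last by rewrite lee_fin ltW.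
apply: Lp_int_triangle => //.
- exact: simple_limit_strongly_measurable (simple_limitB sf (sl n)) (aeW _ (fun=> erefl)).
- apply: strongly_measurableB; first exact: simple_fun_strongly_measurable.
  exact: continuous_strongly_measurable.
- by move=> t _; apply: le_trans (ler_normD _ _); rewrite subrKA.
Unshelve. all: by end_near. Qed.

(** Uniform continuity on [0,1], in covering form: t and the left end of its cell are at most
    1/(N+1) apart. *)
Lemma cell_uniform (c : R -> V) (eta : R) : continuous c -> 0 < eta ->
  \forall N \near \oo, forall t : R, 0 <= t <= 1 -> `|c t - c ((cell N t)%:~R / N.+1%:R)| <= eta.
Proof.
move=> cc eta0.
have /compact_near_coveringP := @segment_compact R 0 1.
move=> /(_ nat \oo (fun N t => `|c t - c ((cell N t)%:~R / N.+1%:R)| <= eta) _).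
have H : (forall x : R, `[0, 1]%classic x ->
    \forall x' \near x & i \near \oo, `|c x' - c ((cell i x')%:~R / i.+1%:R)| <= eta).
  move=> x _.
  have /cvgrPdist_le /(_ (eta / 2)) /(_ (divr_gt0 eta0 _)) := cc x.
  move=> /(_ _)/nbhs_ballP[|d /= d0 dc]; first by [].
  exists (ball x (d / 2), [set N | N.+1%:R^-1 < d / 2]).
    split; first by apply: nbhsx_ballx; exact: divr_gt0.
    have d2 : 0 < d / 2 by exact: divr_gt0.
    exact: (near_infty_natSinv_lt (PosNum d2)).
  move=> [t N] [/= xt Nd].
  have [/dc h1 /dc h2] : ball x d t /\ ball x d ((cell N t)%:~R / N.+1%:R).
    move: xt; rewrite /ball /= /ball_ /= => xt; split; first by apply: lt_trans xt _; lra.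
    have /andP[h3 h4] := cell_dist N t.
    have -> : x - (cell N t)%:~R / N.+1%:R = (x - t) + (t - (cell N t)%:~R / N.+1%:R) by
      rewrite addrA subrK.
    apply: le_lt_trans (ler_normD _ _) _; rewrite [X in _ + X]ger0_norm//.
    by rewrite [ltRHS]splitr; apply: ltrD => //; exact: le_lt_trans Nd.
  have -> : c t - c ((cell N t)%:~R / N.+1%:R) = (c x - c ((cell N t)%:~R / N.+1%:R)) - (c x -
    c t).
    by rewrite opprB [RHS]addrC subrKA.
  by apply: le_trans (ler_normB _ _) _; rewrite [leRHS]splitr; apply: lerD.
move=> /(_ H); apply: filterS => N HN t t01; apply: HN; by rewrite /= in_itv.
Qed.

(** Otherwise shifts could be chosen greedily with translates pairwise eps-apart on the unit window,
    and two consecutive terms of a convergent subsequence would contradict this. *)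
Lemma translation_compact_totally_bounded (g : R -> V) : strongly_measurable g ->
  translation_compact p g -> forall eps : R, 0 < eps -> exists l : seq R, forall s,
    exists2 s', s' \in l &
      (Lp_int p (fun t => (g (t + s) - g (t + s'))%R) `[0%R, 1%R] <= eps%:E)%E.
Proof.
move=> mg TC eps eps0; apply: contrapT => nTB.
have far (l : seq R) : exists s, forall s', s' \in l ->
    ~ (Lp_int p (fun t => (g (t + s) - g (t + s'))%R) `[0%R, 1%R] <= eps%:E)%E.
  apply: contrapT => H; apply: nTB; exists l => s; apply: contrapT => Hs.
  by apply: H; exists s => s' s'l Hs'; apply: Hs; exists s'.
have [nx nxP] := choice far.
(* [L n] lists the first n choices; the next one, [nx (L n)], is far from all of them. *)
pose L n := iter n (fun l => nx l :: l) [::].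
have Lmono m n : (m < n)%N -> nx (L m) \in L n.
  elim: n => // n IH; rewrite ltnS leq_eqVlt => /predU1P[->|/IH mn]; rewrite /L/= inE ?eqxx//.
  by rewrite mn orbT.
have [phi [h [phi_mono [[mh _] /(_ 0 1) hcvg]]]] := TC (fun n => nx (L n)).
pose A := 2 `^ p : R.
have A0 : 0 < A by apply: powR_gt0.
have e0 : 0 < eps / (A * 2) by apply: divr_gt0 => //; apply: mulr_gt0.
pose r := (eps / (A * 2)) `^ p^-1.
have r0 : 0 < r by apply: powR_gt0.
have rp : r `^ p = eps / (A * 2) by rewrite -powRrM mulVf ?gt_eqF// powRr1// ltW.
have [n _ Hn] := cvge_le_near hcvg r0.
have close m : (n <= m)%N ->
    (Lp_int p (fun t => (g (t + nx (L (phi m))) - h t)%R) `[0%R, 1%R] <= (eps / (A * 2))%:E)%E.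
  by move=> nm; rewrite -rp; apply: (Lp_norm_Lp_int p0 (ltW r0)); exact: Hn.
apply: (nxP _ _ (Lmono _ _ (phi_mono n n.+1 (ltnSn n)))).
have mgs s : strongly_measurable (fun t => g (t + s) - h t).
  by apply: strongly_measurableB => //; exact: strongly_measurable_shift.
have -> : eps = A * (eps / (A * 2) + eps / (A * 2)) by field; rewrite gt_eqF.
rewrite EFinM EFinD.
apply: le_trans (lee_wpmul2l _ (leeD (close n.+1 (leqnSn n)) (close n (leqnn n))));
  last by rewrite lee_fin ltW.
apply: Lp_int_triangle => // t _.
by rewrite [X in _ <= _ + X]distrC; apply: le_trans (ler_normD _ _); rewrite subrKA.
Qed.

Lemma cell_addz N (t : R) (k : int) : cell N (t + k%:~R) = k * N.+1%:Z + cell N t.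
Proof.
apply/eqP; rewrite cellP; have := cellP N t (cell N t); rewrite eqxx => /esym/andP[h1 h2].
have E (j : int) : (k * N.+1%:Z + j)%:~R / N.+1%:R = k%:~R + j%:~R / N.+1%:R :> R.
  by rewrite intrD intrM mulrDl mulfK// gt_eqF// ltr0n.
by rewrite -addrA !E [t + _]addrC lerD2l ltrD2l h1.
Qed.

Lemma cell_unit N (t : R) : 0 <= t < 1 -> 0 <= cell N t < N.+1%:Z.
Proof.
move=> /andP[t0 t1]; rewrite /cell floor_ge_int_tmp/= mulr_ge0//= -(ltr_int R).
apply: le_lt_trans (floor_le_tmp _) _.
by rewrite -[X in _ < X]mulr1 ltr_pM2l// ltr0n.
Qed.

Lemma translation_compact_step (g : R -> V) : Lp_loc p g ->
  translation_compact p g -> step_approximable p g.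
Proof.
move=> [mg Ig] TC eps eps0.
pose A := 2 `^ p : R.
have A0 : 0 < A by apply: powR_gt0.
pose C := A * (1 + A * 2).
have C0 : 0 < C by rewrite mulr_gt0// ltr_pwDl// ?mulr_ge0// ltW.
pose del := Num.min 1 (eps / C).
have del0 : 0 < del by rewrite lt_min ltr01 divr_gt0.
have delp : del `^ p <= del by apply: ge1r_powR; rewrite ?(ltW p1)// del0 ge_min lexx.
have [l Hl] := translation_compact_totally_bounded mg TC del0.
have mgs s : strongly_measurable (fun t => g (t + s)) by exact: strongly_measurable_shift.
have /choice[c cP] (s : R) : exists c : R -> V, continuous c /\
    (Lp_int p (fun t => (g (t + s) - c t)%R) `[0%R, 1%R] <= del%:E)%E.
  have [|c cc cE] := Lp_approximable (mgs s) _ del0; last by exists c.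
  by rewrite Lp_int_shift//; exact: Ig.
(* The net [l] is finite, so one grid serves all its continuous approximants; this makes N
   independent of s. *)
have : \forall N \near \oo, forall s, s \in l -> forall t : R, 0 <= t <= 1 ->
    `|c s t - c s ((cell N t)%:~R / N.+1%:R)| <= del.
  elim: l {Hl} => [|s l IH]; first exact: nearW.
  near=> N => s'; rewrite inE => /predU1P[->|s'l].
    by near: N; exact: cell_uniform (cP s).1 del0.
  by move: s' s'l; near: N.
case=> N _ /(_ N (leqnn N)) HN.
exists N, [seq c s (r%:R / N.+1%:R) | s <- l, r <- iota 0 N.+1] => s.
have /choice[i iP] (k : int) : exists i, i \in l /\
   (Lp_int p (fun t => (g (t + (s + k%:~R)) - g (t + i))%R) `[0%R, 1%R] <= del%:E)%E.
  by have [i il iE] := Hl (s + k%:~R); exists i.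
(* Quotient and remainder of j by N+1 give the unit window and the position of the cell in it. On
   window k the samples come from the approximant of the net element close to the translate by s +
   k. *)
pose w (j : int) := c (i (j %/ N.+1)%Z) ((j %% N.+1)%Z%:~R / N.+1%:R).
have wF j : w j \in [seq c s (r%:R / N.+1%:R) | s <- l, r <- iota 0 N.+1].
  have r0 : (0 <= (j %% N.+1)%Z) by rewrite modz_ge0.
  have r1 : ((j %% N.+1)%Z < N.+1%:Z) by rewrite ltz_pmod.
  apply/allpairsP; exists (i (j %/ N.+1)%Z, absz (j %% N.+1)%Z); split => /=.
  - exact: (iP _).1.
  - by rewrite -[0%N :: _]/(iota 0 N.+1) mem_iota; lia.
  - by rewrite /w; congr (c _ (_ / _)); rewrite -[in LHS](gez0_abs r0).
exists w => // k.
have mw : strongly_measurable (fun t : R => w (cell N t)).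
  exact: simple_fun_strongly_measurable (simple_fun_cell _ (finite_range_seq wF)).
have mf : strongly_measurable (fun t => g (t + s) - w (cell N t)) by exact: strongly_measurableB.
rewrite -[X in `[X, _]]add0r [X in `[_, X]]addrC -(Lp_int_shift p _ _ _ mf).
have wE (t : R) : 0 <= t < 1 -> w (cell N (t + k%:~R)) = c (i k) ((cell N t)%:~R / N.+1%:R).
  move=> t01; have /andP[c0 c1] := cell_unit N t01.
  by rewrite /w cell_addz divzMDl// modzMDl divz_small ?modz_small ?addr0// c0.
have mcs s' : strongly_measurable (c s') by exact: continuous_strongly_measurable (cP s').1.
have step1 : (Lp_int p (fun t => (g (t + i k) - w (cell N (t + k%:~R)))%R) `[0%R, 1%R] <=
    (A * (del + del))%:E)%E.
  have le_cst : (Lp_int p (fun t => (c (i k) t - w (cell N (t + k%:~R)))%R) `[0%R,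
    1%R] <= del%:E)%E.
    apply: le_trans (Lp_int_le_cst (M := del) p0 ler01 _) _.
      move=> t /andP[t0 t1]; rewrite wE ?(ltW t0)//; apply: HN; first exact: (iP k).1.
      by rewrite !ltW.
    by rewrite subr0 mulr1 lee_fin.
  rewrite EFinM EFinD; apply: le_trans (lee_wpmul2l _ (leeD (cP (i k)).2 le_cst));
    last by rewrite lee_fin ltW.
  apply: Lp_int_triangle => //.
  - exact: strongly_measurableB.
  - by apply: strongly_measurableB => //; exact: strongly_measurable_shift mw.
  - by move=> t _; apply: le_trans (ler_normD _ _); rewrite subrKA.
apply: (@le_trans _ _ (A * (del + A * (del + del)))%:E); last first.
  rewrite lee_fin; apply: (@le_trans _ _ (C * del)); first by rewrite le_eqVlt; apply/orP;
    left; apply/eqP; rewrite /C; ring.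
  by rewrite mulrC -ler_pdivlMr// ge_min lexx orbT.
rewrite EFinM EFinD; apply: le_trans (lee_wpmul2l _ (leeD (iP k).2 step1));
  last by rewrite lee_fin ltW.
apply: Lp_int_triangle => //.
- exact: strongly_measurableB.
- by apply: strongly_measurableB => //; exact: strongly_measurable_shift mw.
- move=> t _; rewrite -addrA [k%:~R + s]addrC; apply: le_trans (ler_normD _ _).
  by rewrite subrKA.
Unshelve. all: by end_near. Qed.

End Density.

(** * Step-approximable functions are translation compact *)

Section Diagonal.

Definition unbounded_set (A : set nat) := forall N, exists2 n, (N < n)%N & A n.

(** If each colour occurred only boundedly often in A, an element of A above the finitely many
    bounds would have no colour. *)
Lemma unbounded_pigeonhole (A : set nat) (c : nat -> nat) (K : nat) :
  unbounded_set A -> (forall n, (c n < K)%N) ->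
  exists x, unbounded_set (A `&` [set n | c n = x]).
Proof.
move=> uA cK; apply: contrapT => H.
have /choice[b bP] (x : nat) : exists b, forall n, (b < n)%N -> A n -> c n <> x.
  apply: contrapT => Hx; apply: H; exists x => N; apply: contrapT => HN.
  by apply: Hx; exists N => n Nn An cn; apply: HN; exists n.
have [n bn An] := uA (\max_(x < K) b x).
apply: (bP (c n) n _ An erefl); apply: leq_ltn_trans bn.
exact: (leq_bigmax (Ordinal (cK n))).
Qed.

(** Nested unbounded sets: passing from S m to S (m+1) fixes colour m. The n-th term is drawn from S
    (n+1) rather than S n, so that the case m = n is included. *)
Lemma diagonal_pigeonhole (c : nat -> nat -> nat) (K : nat -> nat) :
  (forall m n, (c m n < K m)%N) ->
  exists2 phi : nat -> nat, {homo phi : m n / (m < n)%N >-> (m < n)%N} &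
    exists P : nat -> nat, forall m n, (m <= n)%N -> c m (phi n) = P m.
Proof.
move=> cK.
have /choice[x xP] (mA : nat * set nat) : exists x, unbounded_set mA.2 ->
    unbounded_set (mA.2 `&` [set n | c mA.1 n = x]).
  have [uA|nA] := pselect (unbounded_set mA.2); last by exists 0%N.
  by have [x Hx] := unbounded_pigeonhole uA (cK mA.1); exists x.
pose S := fix S m : set nat := if m is m'.+1 then
  S m' `&` [set n | c m' n = x (m', S m')] else setT.
have uS m : unbounded_set (S m).
  elim: m => [|m IH]; first by move=> N; exists N.+1.
  exact: (xP (m, S m)).
have Ssub m n : (m <= n)%N -> S n `<=` S m.
  elim: n => [|n IH]; first by rewrite leqn0 => /eqP->.
  rewrite leq_eqVlt => /predU1P[->//|mn] k [Sk _]; exact: IH Sk.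
have /choice[nx nxP] (mN : nat * nat) : exists n, (mN.2 < n)%N /\ S mN.1 n.
  by have [n h1 h2] := uS mN.1 mN.2; exists n.
pose phi := fix phi n := if n is n'.+1 then nx (n.+1, phi n') else nx (1%N, 0%N).
have phiS n : S n.+1 (phi n) by case: n => [|n];
  [exact: (nxP (1%N, 0%N)).2|exact: (nxP (n.+2, phi n)).2].
exists phi.
  have step n : (phi n < phi n.+1)%N by exact: (nxP (n.+2, phi n)).1.
  move=> m n; elim: n => // n IH; rewrite ltnS leq_eqVlt => /predU1P[->//|/IH mn].
  exact: ltn_trans (step n).
exists (fun m => x (m, S m)) => m n mn.
by have [] : S m.+1 (phi n) by apply: Ssub (phiS n).
Qed.

End Diagonal.

(** * Completeness and the limit of geometrically close functions *)

Section GeometricCauchy.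
Context {R : realType} {V : completeNormedModType R}.

Lemma geometric_cauchy (w : nat -> V) (r : R) : 0 <= r ->
  (forall m, `|w m - w m.+1| <= r / 2 ^+ m) ->
  w @ \oo --> lim (w @ \oo) /\ forall m, `|w m - lim (w @ \oo)| <= 2 * r / 2 ^+ m.
Proof.
move=> r0 wr.
have p2 m : 0 < 2 ^+ m :> R by rewrite exprn_gt0.
(* The right side is the exact sum of r/2^i over m <= i < m + k, which lets the induction close. *)
have tail m k : `|w m - w (m + k)%N| <= 2 * r / 2 ^+ m - 2 * r / 2 ^+ (m + k).
  elim: k => [|k IH]; first by rewrite addn0 !subrr normr0.
  have -> : w m - w (m + k.+1)%N = (w m - w (m + k)%N) + (w (m + k)%N - w (m + k).+1).
    by rewrite subrKA addnS.
  apply: le_trans (ler_normD _ _) _; apply: le_trans (lerD IH (wr _)) _.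
  have -> : 2 * r / 2 ^+ (m + k.+1) = r / 2 ^+ (m + k).
    by rewrite addnS exprS invfM mulrACA divff ?mul1r// pnatr_eq0.
  rewrite le_eqVlt; apply/orP; left; apply/eqP; ring.
have le_tail m n : (m <= n)%N -> `|w m - w n| <= 2 * r / 2 ^+ m.
  move=> mn; rewrite -(subnKC mn); apply: le_trans (tail _ _) _.
  by rewrite gerBl divr_ge0 ?mulr_ge0 ?(ltW (p2 _)).
have small e : 0 < e -> \forall m \near \oo, 2 * r / 2 ^+ m <= e.
  move=> e0; have z1 : `|2^-1 : R| < 1 by rewrite ger0_norm// invf_lt1// ltr1n.
  have /cvgrPdist_le /(_ e e0) := cvg_geometric (2 * r) z1.
  apply: filterS => m; rewrite /geometric /= sub0r normrN -exprVn => H.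
  exact: le_trans (ler_norm _) H.
have wcvg : cvg (w @ \oo).
  apply: cauchy_cvg; apply/cauchy_exP => e e0.
  have e2 : 0 < e / 2 by exact: divr_gt0.
  have [m _ /(_ m (leqnn m)) me] := small _ e2.
  exists (w m); exists m => // n mn; rewrite -ball_normE /ball_ /=.
  apply: le_lt_trans (le_tail _ _ mn) _; apply: le_lt_trans me _.
  by rewrite ltr_pdivrMr// ltr_pMr// ltr1n.
split => // m.
have cvgn : (fun n => `|w m - w n|) @ \oo --> `|w m - lim (w @ \oo)|.
  by apply: cvg_norm; apply: cvgB; [exact: cvg_cst|exact: wcvg].
rewrite -(cvg_lim _ cvgn)//; apply: limr_le; first by apply: cvgP cvgn.
near=> n; apply: le_tail; near: n; exact: nbhs_infty_ge.
Unshelve. all: by end_near. Qed.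

End GeometricCauchy.

Section RieszFischer.
Context {R : realType} {V : completeNormedModType R}.
Local Notation mu := (@lebesgue_measure R).
Variable p : R.
Hypothesis p1 : 1 < p.
Let p0 : 0 < p. Proof. exact: lt_trans p1. Qed.
Let p0' : 0 <= p. Proof. exact: ltW. Qed.
Let A := 2 `^ p : R.
Let A0 : 0 < A. Proof. exact: powR_gt0. Qed.

Let A2 : 2 <= A.
Proof. by apply: le1r_powR (ltW p1); rewrite ler1n. Qed.

Lemma powR_expn (x : R) m : 0 <= x -> (x ^+ m) `^ p = (x `^ p) ^+ m.
Proof. by move=> x0; elim: m => [|m IH];
  rewrite ?expr0 ?powR1// !exprS powRM ?exprn_ge0// IH. Qed.

(** As A^m = (2^m)^p, taking p-th roots turns the hypothesis into increments of at most r/2^m with r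
    = Phi^(1/p). *)
Lemma weighted_cauchy (w : nat -> V) (Phi : R) : 0 <= Phi ->
  (forall m, A ^+ m * `|w m - w m.+1| `^ p <= Phi) ->
  w @ \oo --> lim (w @ \oo) /\ forall m, `|w m - lim (w @ \oo)| `^ p <= A * Phi / A ^+ m.
Proof.
move=> P0 wP.
pose r := Phi `^ p^-1.
have r0 : 0 <= r by exact: powR_ge0.
have rp : r `^ p = Phi by rewrite -powRrM mulVf ?gt_eqF// powRr1.
have p2 m : 0 < 2 ^+ m :> R by rewrite exprn_gt0.
have [|wc wl] := @geometric_cauchy _ _ w r r0.
  move=> m; rewrite ler_pdivlMr// mulrC.
  have : (2 ^+ m * `|w m - w m.+1|) `^ p <= r `^ p.
    by rewrite rp powRM ?(ltW (p2 _))// powR_expn//; exact: wP.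
  apply: contraTT; rewrite -!ltNge => H.
  by apply: (gt0_ltr_powR p0); rewrite ?nnegrE ?mulr_ge0 ?(ltW (p2 _)).
split => // m.
have -> : A * Phi / A ^+ m = (2 * r / 2 ^+ m) `^ p.
  have i2 : (2^-1 : R) `^ p = A^-1.
    apply: (mulfI (x := A)); first by rewrite gt_eqF.
    by rewrite -powRM// !divff ?pnatr_eq0 ?powR1 ?gt_eqF.
  by rewrite -exprVn powRM ?mulr_ge0 ?exprn_ge0 ?invr_ge0// powRM// rp powR_expn ?invr_ge0//
    i2 exprVn.
by apply: ge0_ler_powR; rewrite ?nnegrE ?divr_ge0 ?mulr_ge0 ?(ltW (p2 _)).
Qed.

Local Notation J K := (`[(- (K%:R : R))%R, (K%:R : R)%R]%classic).

(** After weighting by A^m, the rate (2A)^-m still leaves 2^-m, so the weighted series is integrable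
    on each window. Where it is finite, [weighted_cauchy] gives convergence at rate A^-m. *)
Lemma riesz_fischer (W : nat -> R -> V) (C : nat -> R) :
  (forall m, simple_fun (W m)) ->
  (forall K m, (K <= m)%N ->
    (Lp_int p (fun t => (W m t - W m.+1 t)%R) (J K) <= (C K / (2 * A) ^+ m)%:E)%E) ->
  exists2 h : R -> V, strongly_measurable h &
    forall K, exists I : R, forall m, (K <= m)%N ->
      (Lp_int p (fun t => (W m t - h t)%R) (J K) <= (I / A ^+ m)%:E)%E.
Proof.
move=> sW WC.
(* At points of divergence this is a default value; they form a null set. *)
pose h t := lim (W ^~ t @ \oo).
(* [Phi] dominates the p-th powers of the tails |W m - h|, so no Fatou argument is needed. *)
pose f K m t := ((A ^+ m)%:E * (`|W (K + m)%N t - W (K + m).+1 t| `^ p)%:E)%E.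
pose Phi K t := (\sum_(0 <= m <oo) f K m t)%E.
have An m : 0 < A ^+ m by exact: exprn_gt0.
have mD m n : measurable_fun setT (fun t => (`|W m t - W n t| `^ p)%:E).
  by apply: simple_limit_powR_measurable; apply: simple_limitB; exact: simple_fun_limit.
have mf K m : measurable_fun (J K) (f K m).
  by apply: measurable_funTS; apply: measurable_funeM; exact: mD.
have f0 K m t : (0 <= f K m t)%E by rewrite mule_ge0// lee_fin ?powR_ge0// ltW.
have Phi0 K t : (0 <= Phi K t)%E by apply: nneseries_ge0 => m _ _; exact: f0.
have mPhi K : measurable_fun (J K) (Phi K).
  by apply: ge0_emeasurable_sum => // m t _ _; exact: f0.
have IPhi K : (\int[mu]_(t in J K) Phi K t <= (2 * `|C K|)%:E)%E.
  rewrite integral_nneseries//; last by move=> n; exact: mf.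
  have term m : (\int[mu]_(t in J K) f K m t <= (`|C K| / 2 ^+ m)%:E)%E.
    rewrite ge0_integralZl//; last 2 first.
    - by apply: measurable_funTS; exact: mD.
    - by rewrite lee_fin ltW.
    apply: (@le_trans _ _ ((A ^+ m)%:E * (C K / (2 * A) ^+ (K + m))%:E)%E).
      by apply: lee_wpmul2l; [rewrite lee_fin ltW|exact: WC (leq_addr _ _)].
    rewrite -EFinM lee_fin.
    have AA0 j : 0 < (2 * A) ^+ j by rewrite exprn_gt0// mulr_gt0.
    apply: (@le_trans _ _ (A ^+ m * (`|C K| / (2 * A) ^+ m))).
      rewrite ler_wpM2l ?(ltW (An _))//.
      apply: (@le_trans _ _ (`|C K| / (2 * A) ^+ (K + m))).
        by rewrite ler_wpM2r ?invr_ge0 ?(ltW (AA0 _))// ler_norm.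
      rewrite ler_wpM2l// lef_pV2 ?posrE//.
      apply: ler_weXn2l; last exact: leq_addl.
      by apply: le_trans (ler_peMr _ _) => //; rewrite ?ler1n// (le_trans _ A2)// ler1n.
    by rewrite exprMn mulrC -mulrA invfM -[_ * _ * A ^+ m]mulrA mulVf ?mulr1 ?gt_eqF.
  apply: lime_le; first by apply: is_cvg_nneseries => n _ _; apply: integral_ge0 => t _;
    exact: f0.
  apply: nearW => n; apply: (@le_trans _ _ (2 * `|C K| - 2 * `|C K| / 2 ^+ n)%:E); last first.
    by rewrite lee_fin gerBl divr_ge0// ?mulr_ge0// exprn_ge0.
  elim: n => [|n IH]; first by rewrite big_geq// expr0 divr1 subrr.
  rewrite big_nat_recr//=; apply: le_trans (leeD IH (term n)) _.
  rewrite -EFinD lee_fin.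
  have -> : 2 * `|C K| / 2 ^+ n.+1 = `|C K| / 2 ^+ n.
    by rewrite exprS invfM mulrACA divff ?mul1r// pnatr_eq0.
  rewrite le_eqVlt; apply/orP; left; apply/eqP; ring.
have aePhi K : {ae mu, forall t, J K t -> Phi K t \is a fin_num}.
  apply: integrable_ae => //; apply/integrableP; split; first exact: mPhi.
  under eq_integral do rewrite gee0_abs//.
  by apply: le_lt_trans (IPhi K) _; exact: ltry.
have key K t : Phi K t \is a fin_num -> W ^~ t @ \oo --> h t /\
    forall m, (K <= m)%N -> `|W m t - h t| `^ p <= A ^+ K.+1 / A ^+ m * fine (Phi K t).
  move=> Pfin; pose w m := W (K + m)%N t.
  have [|m|wc wl] := @weighted_cauchy w (fine (Phi K t)); first exact: fine_ge0.
    rewrite -lee_fin fineK//; apply: le_trans (nneseries_lim_ge m.+1 _); last by move=> *;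
      exact: f0.
    rewrite big_nat_recr//= /f /w addnS EFinM; apply: leeDr.
    by apply: sume_ge0 => j _; exact: f0.
  have Wc : W ^~ t @ \oo --> lim (w @ \oo).
    rewrite -(cvg_shiftn K); have -> : (fun n => W (n + K)%N t) = w by apply/funext => n;
      rewrite /w addnC.
    exact: wc.
  have hE : h t = lim (w @ \oo) by exact: cvg_lim Wc.
  split=> [|m Km]; first by rewrite hE.
  have := wl (m - K)%N; rewrite /w subnKC// -hE => /le_trans; apply.
  rewrite le_eqVlt; apply/orP; left; apply/eqP.
  rewrite -{2}(subnKC Km) exprD exprS; field.
  by rewrite !gt_eqF.
exists h.
  exists W; split => //.
  (* Countably many windows J K cover the line, so almost every t has a finite majorant for some K
     with t in J K. *)
  have := ae_foralln aePhi; apply: ae_imp => t Ht.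
  have [] := key (Num.bound `|t|) t => //; apply: Ht => /=.
  have := archi_boundP (normr_ge0 t); rewrite in_itv/= -ler_norml => /ltW; exact.
move=> K; exists (A ^+ K.+1 * (2 * `|C K|)) => m Km.
have c0 : 0 <= A ^+ K.+1 / A ^+ m by rewrite divr_ge0 ?(ltW (An _)).
apply: (@le_trans _ _ (\int[mu]_(t in J K) ((A ^+ K.+1 / A ^+ m)%:E * Phi K t))%E).
  apply: ae_le_lower_integral => [t|t|].
  - by rewrite lee_fin powR_ge0.
  - by rewrite mule_ge0// lee_fin.
  apply: ae_imp (aePhi K) => t Ht Jt; split => //.
  have [_ /(_ m Km)] := key K t (Ht Jt).
  by rewrite -lee_fin EFinM fineK//; exact: Ht.
rewrite ge0_integralZl//; last exact: mPhi.
apply: le_trans (lee_wpmul2l _ (IPhi K)) _; first by rewrite lee_fin.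
by rewrite -EFinM lee_fin mulrAC.
Qed.

End RieszFischer.

Lemma cvge0_near_le {R : realType} (u : nat -> \bar R) : (forall n, (0 <= u n)%E) ->
  (forall e : R, 0 < e -> \forall n \near \oo, (u n <= e%:E)%E) -> u @ \oo --> 0%E.
Proof.
move=> u0 ue; apply/fine_cvgP; split.
  have := ue 1 ltr01; apply: filterS => n un.
  by rewrite ge0_fin_numE//; apply: le_lt_trans un _; exact: ltry.
apply/cvgrPdist_le => e e0; have := ue e e0; apply: filterS => n un.
rewrite /= sub0r normrN ger0_norm; last exact: fine_ge0.
by rewrite -lee_fin fineK// ge0_fin_numE//; apply: le_lt_trans un _; exact: ltry.
Qed.

Section StepTranslationCompact.
Context {R : realType} {V : completeNormedModType R}.
Variable p : R.
Hypothesis p1 : 1 < p.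
Let p0 : 0 < p. Proof. exact: lt_trans p1. Qed.
Let p0' : 0 <= p. Proof. exact: ltW. Qed.
Let A := 2 `^ p : R.
Let A0 : 0 < A. Proof. exact: powR_gt0. Qed.
Let A2 : 2 <= A.
Proof. by apply: le1r_powR (ltW p1); rewrite ler1n. Qed.
Local Notation J K := (`[(- (K%:R : R))%R, (K%:R : R)%R]%classic).

(** The restriction of w to the 2m(N+1) cells of [-m, m], encoded in a finite type so that the
    pigeonhole applies through [enum_rank]; the extra ordinal beyond size F is there for [inord]. *)
Definition window_pattern (N m : nat) (F : seq V) (w : int -> V) :=
  [ffun i : 'I_((m * N.+1).*2) => inord (index (w (i%:Z - (m * N.+1)%:Z)) F) : 'I_(size F).+1].

Lemma window_patternP N m (F : seq V) (w w' : int -> V) :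
  (forall j, w j \in F) -> (forall j, w' j \in F) ->
  window_pattern N m F w = window_pattern N m F w' ->
  forall j : int, - (m * N.+1)%:Z <= j < (m * N.+1)%:Z -> w j = w' j.
Proof.
move=> wF w'F /ffunP E j jm.
have ij : (absz (j + (m * N.+1)%:Z)%R < (m * N.+1).*2)%N by lia.
have := E (Ordinal ij); rewrite !ffunE /= => /(congr1 val) /=.
have -> : (absz (j + (m * N.+1)%:Z)%R)%:Z - (m * N.+1)%:Z = j by lia.
rewrite !inordK ?ltnS ?index_size// => idx.
by rewrite -(nth_index 0 (wF j)) idx nth_index.
Qed.

(** Along the diagonal subsequence, the m-th step approximations of all translates from the m-th on
    share one pattern on [-m, m], so that of s (phi m) serves for all. The factor [K.*2] counts the
    unit windows in J K. *)
Lemma step_translates (g : R -> V) (s : nat -> R) (eps : nat -> R) :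
  strongly_measurable g -> step_approximable p g -> (forall m, 0 < eps m) ->
  exists2 phi : nat -> nat, {homo phi : m n / (m < n)%N >-> (m < n)%N} &
    exists2 W : nat -> R -> V, (forall m, simple_fun (W m)) /\ (forall m, exists B :
      R, forall t, `|W m t| <= B) &
      forall K m n, (K <= m)%N -> (m <= n)%N ->
        (Lp_int p (fun t => (g (t + s (phi n)) - W m t)%R) (J K) <= (K.*2%:R * eps m)%:E)%E.
Proof.
move=> mg SA eps0.
have /choice[NF NFP] (m : nat) : exists NF : nat * seq V, forall s' : R,
    exists2 w : int -> V, (forall j, w j \in NF.2) &
      forall k : int, (Lp_int p (fun t => (g (t + s') - w (cell NF.1 t))%R)
                        `[k%:~R, (k%:~R + 1)%R] <= (eps m)%:E)%E.
  by have [N [F H]] := SA _ (eps0 m); exists (N, F).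
have /choice[w wP] (mn : nat * nat) : exists w : int -> V, (forall j, w j \in (NF mn.1).2) /\
      forall k : int, (Lp_int p (fun t => (g (t + s mn.2) - w (cell (NF mn.1).1 t))%R)
                        `[k%:~R, (k%:~R + 1)%R] <= (eps mn.1)%:E)%E.
  by have [w w1 w2] := NFP mn.1 (s mn.2); exists w.
pose pat m n := window_pattern (NF m).1 m (NF m).2 (w (m, n)).
have [phi phi_mono [P phiP]] := @diagonal_pigeonhole (fun m n => enum_rank (pat m n)) _
  (fun m n => ltn_ord (enum_rank (pat m n))).
exists phi => //.
have sW m : simple_fun (fun t : R => w (m, phi m) (cell (NF m).1 t)).
  exact: simple_fun_cell _ (finite_range_seq (wP (m, phi m)).1).
exists (fun m t => w (m, phi m) (cell (NF m).1 t)).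
  split => // m; have [B _ HB] := seq_norm_bound (NF m).2.
  by exists B => t; apply: HB; exact: (wP (m, phi m)).1.
move=> K m n Km mn.
have wE (j : int) : - (m * (NF m).1.+1)%:Z <= j < (m * (NF m).1.+1)%:Z -> w (m,
  phi m) j = w (m, phi n) j.
  apply: (window_patternP (wP (m, phi m)).1 (wP (m, phi n)).1).
  by apply: enum_rank_inj; apply: ord_inj; rewrite !phiP.
have mgW : strongly_measurable (fun t => g (t + s (phi n)) - w (m, phi m) (cell (NF m).1 t)).
  apply: strongly_measurableB; first exact: strongly_measurable_shift.
  exact: simple_fun_strongly_measurable.
have := @Lp_int_uniform_split _ _ p _ g (- K%:R) 1 0 (eps m) K.*2 ler01 (lexx 0) mgW mg.
rewrite /= mulr1 mul0e add0e.
have -> : - K%:R + K.*2%:R = K%:R :> R by rewrite -addnn natrD addKr.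
apply => i iK; rewrite mul0e add0e !mulr1.
pose k : int := i%:Z - K%:Z.
have -> : - K%:R + i%:R = k%:~R :> R by rewrite /k intrB addrC.
have -> : - K%:R + i.+1%:R = k%:~R + 1 :> R by rewrite /k intrB -natr1 addrA [- _ + _]addrC.
apply: le_trans ((wP (m, phi n)).2 k); rewrite Lp_int_itvoo [leRHS]Lp_int_itvoo.
apply: ae_le_Lp_int; apply: aeW => t tI; split => //=.
rewrite wE//.
have [t0 t1] : k%:~R <= t /\ t < k%:~R + 1 by move: tI; rewrite /= in_itv/= => /andP[/ltW].
have tk : t = (t - k%:~R) + k%:~R by rewrite subrK.
have : 0 <= t - k%:~R < 1 by rewrite subr_ge0 t0 ltrBlDr addrC.
move=> /(cell_unit (NF m).1) /andP[c0 c1].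
rewrite tk cell_addz; move: c0 c1; set cc := cell _ _; rewrite /k; clear -Km iK.
move: (NF m).1 => N c0 c1.
have h1 : - m%:Z <= i%:Z - K%:Z by lia.
have h2 : i%:Z - K%:Z + 1 <= m%:Z by lia.
rewrite PoszM; apply/andP; split; nia.
Qed.

Lemma step_translation_compact (g : R -> V) : strongly_measurable g ->
  step_approximable p g -> translation_compact p g.
Proof.
move=> mg SA s.
have AA0 m : 0 < (2 * A) ^+ m by rewrite exprn_gt0// mulr_gt0.
have An m : 0 < A ^+ m by exact: exprn_gt0.
(* The accuracies (2A)^-m are those that [riesz_fischer] asks for. *)
have e0 m : 0 < ((2 * A) ^+ m)^-1 by rewrite invr_gt0.
have [phi phi_mono [W [sW bW] WP]] := step_translates s mg SA e0.
have mW m : strongly_measurable (W m) by exact: simple_fun_strongly_measurable.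
have mgs r : strongly_measurable (fun t => g (t + r)) by exact: strongly_measurable_shift.
(* W m and W (m+1) are both compared with the translate by s (phi (m+1)), each at cost 2K (2A)^-m on
   J K. *)
have [|h mh hW] := @riesz_fischer _ _ p p1 W (fun K => A * (K.*2%:R + K.*2%:R)) sW.
  move=> K m Km.
  apply: (@le_trans _ _ (A%:E * ((K.*2%:R / (2 * A) ^+ m)%:E + (K.*2%:R / (2 * A) ^+
    m)%:E))%E); last first.
    by rewrite -EFinD -EFinM lee_fin -mulrDl mulrA.
  have le_m : (Lp_int p (fun t => (g (t + s (phi m.+1)) - W m.+1 t)%R) (J K) <= (K.*2%:R / (2
    * A) ^+ m)%:E)%E.
    apply: le_trans (WP K m.+1 m.+1 (leqW Km) (leqnn _)) _.
    rewrite lee_fin ler_wpM2l// lef_pV2 ?posrE//.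
    by apply: ler_weXn2l => //; have := A2; lra.
  apply: le_trans (lee_wpmul2l _ (leeD (WP K m m.+1 Km (leqnSn _)) le_m));
    last by rewrite lee_fin ltW.
  apply: Lp_int_triangle => //; [exact: strongly_measurableB..|].
  move=> t _; rewrite [X in _ <= X + _]distrC; apply: le_trans (ler_normD _ _).
  by rewrite subrKA.
have itvK (a b : R) : exists K, `[a, b]%classic `<=` J K.
  exists (Num.bound (`|a| + `|b|)); apply: subset_itv; rewrite bnd_simp.
    have := archi_boundP (addr_ge0 (normr_ge0 a) (normr_ge0 b)).
    by have := ler_norm (- a); rewrite normrN; have := normr_ge0 b; lra.
  have := archi_boundP (addr_ge0 (normr_ge0 a) (normr_ge0 b)).
  by have := ler_norm b; have := normr_ge0 a; lra.
have JK0 K : - K%:R <= K%:R :> R by rewrite ge0_cp// ler0n.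
exists phi, h; split => //; split.
  split => // a b; have [K abK] := itvK a b.
  apply: le_lt_trans (Lp_int_subset p h abK) _.
  (* Local integrability of h: W K is bounded, and W K - h has finite integral on J K. *)
  have [I /(_ K (leqnn K)) HI] := hW K; have [B HB] := bW K.
  have WB : (Lp_int p (W K) (J K) <= (B `^ p * (K%:R - - K%:R))%:E)%E by apply: Lp_int_le_cst.
  apply: (@le_lt_trans _ _ (A%:E * ((B `^ p * (K%:R - - K%:R))%:E + (I / A ^+ K)%:E))%E);
    last first.
    by rewrite -EFinD -EFinM ltry.
  apply: le_trans (lee_wpmul2l _ (leeD WB HI)); last by rewrite lee_fin ltW.
  apply: Lp_int_triangle => //; first exact: strongly_measurableB.
  by move=> t _; rewrite -[X in `|X| <= _](subKr (W K t)); exact: ler_normB.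
move=> a b; have [K abK] := itvK a b; have [I HI] := hW K.
apply: cvge0_near_le => [n|e e_gt0]; first exact: poweR_ge0.
(* Collects the distance from the translate to W n and that from W n to h, both weakened to the
   common rate A^-n. *)
pose c := A * (K.*2%:R + `|I|).
have c0 : 0 <= c by rewrite mulr_ge0 ?(ltW A0)// addr_ge0.
have near_c : \forall n \near \oo, c / A ^+ n <= e `^ p.
  have z1 : `|A^-1| < 1.
    by rewrite ger0_norm ?invr_ge0 ?(ltW A0)// invf_lt1// (lt_le_trans _ A2)// ltr1n.
  have /cvgrPdist_le /(_ (e `^ p) (powR_gt0 _ e_gt0)) := cvg_geometric c z1.
  apply: filterS => n; rewrite /geometric /= sub0r normrN -exprVn => H.
  exact: le_trans (ler_norm _) H.
near=> n; apply: (Lp_int_Lp_norm p0 (ltW e_gt0)).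
have Kn : (K <= n)%N by near: n; exact: nbhs_infty_ge.
apply: le_trans (Lp_int_subset _ _ abK) _.
apply: (@le_trans _ _ (c / A ^+ n)%:E); last by rewrite lee_fin; near: n.
have IA : (Lp_int p (fun t => (W n t - h t)%R) (J K) <= (`|I| / A ^+ n)%:E)%E.
  by apply: le_trans (HI n Kn) _; rewrite lee_fin ler_wpM2r ?invr_ge0 ?(ltW (An n))// ler_norm.
have WA : (Lp_int p (fun t => (g (t + s (phi n)) - W n t)%R) (J K) <= (K.*2%:R / A ^+ n)%:E)%E.
  apply: le_trans (WP K n n Kn (leqnn n)) _; rewrite lee_fin ler_wpM2l// lef_pV2 ?posrE//.
  by apply: lerXn2r; rewrite ?nnegrE ?mulr_ge0 ?(ltW A0)// ler_peMl ?(ltW A0)// ler1n.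
have -> : c / A ^+ n = A * (K.*2%:R / A ^+ n + `|I| / A ^+ n) by rewrite /c -mulrDl mulrA.
rewrite EFinM EFinD; apply: le_trans (lee_wpmul2l _ (leeD WA IA)); last by rewrite lee_fin ltW.
apply: Lp_int_triangle => //; [exact: strongly_measurableB..|].
by move=> t _; apply: le_trans (ler_normD _ _); rewrite subrKA.
Unshelve. all: by end_near. Qed.

End StepTranslationCompact.

Theorem theorem2p8 (R : realType) (V : completeNormedModType R) (p : R)
  (g : R -> V) :
  @reflexive_space R V -> 1 < p -> Lp_b p g ->
  ((space_regular p g /\ time_regular p g) <-> translation_compact p g).
Proof.
move=> _ p1 Lg; have [[mg _] _] := Lg; split => [[SR TR]|TC].
  by apply: (step_translation_compact p1) => //; exact: regular_step_approximable.
have SA := translation_compact_step p1 Lg.1 TC.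
by split; [exact: step_space_regular|exact: step_time_regular].
Qed.
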